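(* Let $d$ and $n$ be positive integers, and let $\epsilon>0$. There is a $q_0=q_0(d,n,\epsilon)>0$ such that for all prime powers $q\geq q_0$ and all $c_1,c_2,\ldots,c_n\in\mathbb{F}_q$ the following holds: every cycle type of a first-order cyclotomic permutation of $\mathbb{F}_q$ of index $d$ all of whose cycles on $\mathbb{F}_q^{\ast}$ are of length at least $\epsilon q$ is the cycle type of some first-order cyclotomic permutation $f$ of $\mathbb{F}_q$ of index $d$ such that $f+c_1\operatorname{id},f+c_2\operatorname{id},\ldots,f+c_n\operatorname{id}$ are all permutations of $\mathbb{F}_q$.
   Context: For a prime power $q$ and a divisor $d$ of $q-1$, let $C$ be the index $d$ subgroup of $\mathbb{F}_q^{\ast}$. A first-order cyclotomic mapping of $\mathbb{F}_q$ of index $d$ is a function $f:\mathbb{F}_q\to\mathbb{F}_q$ such that $f(0)=0$ and, for each coset $\mathcal{C}$ of $C$ in $\mathbb{F}_q^{\ast}$, there is a constant $a_{\mathcal{C}}\in\mathbb{F}_q$ with $f(x)=a_{\mathcal{C}}x$ for all $x\in\mathcal{C}$. (If $d\nmid q-1$, there are no such mappings, and the statement is vacuous for $q$.) A first-order cyclotomic permutation of index $d$ is such a mapping that is also a permutation of $\mathbb{F}_q$; it fixes $0$ and permutes $\mathbb{F}_q^{\ast}$. The cycle type of a permutation of a finite set is the information how many disjoint cycles of each length it has (fixed points counted as cycles of length $1$). The function $f+c\operatorname{id}$ is $x\mapsto f(x)+cx$. *)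

(* Defs.v *)
From mathcomp Require Import all_boot all_order all_algebra all_fingroup.
From mathcomp Require Import reals.

Set Implicit Arguments.
Unset Strict Implicit.
Unset Printing Implicit Defensive.

Import Order.TTheory GRing.Theory Num.Theory.
Local Open Scope ring_scope.

(* F^* is cyclic, so a subgroup C of index d exists iff d divides #|F| - 1,
   and it is then unique. *)
Definition cyclotomic_mapping (F : finFieldType) (d : nat) (f : F -> F) : Prop :=
  f 0 = 0 /\
  exists C : {group {unit F}},
    #|[set: {unit F}] : C|%g = d /\
    forall K : {set {unit F}}, K \in lcosets C [set: {unit F}] ->
      exists a : F, forall x : {unit F}, x \in K -> f (val x) = a * val x.

(* porbits s contains the singleton orbits, so fixed points are counted. *)
Definition cycle_type (T : finType) (s : {perm T}) : nat -> nat :=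
  fun l => #|[set X in porbits s | #|X| == l]|.

(* Main.v *)
(** A first-order cyclotomic permutation maps x to b_K x on each coset K, so it permutes the cosets,
    and its cycle type is determined by the cycles of that coset permutation pi together with the
    orders of the products of the b_K along them.  We keep pi and these orders and only change the
    coefficients, asking moreover that b_K + c_j lie in the coset b_K C; then f + c_j id permutes the
    cosets exactly as f does.  Along a cycle of pi all but one of the coefficients can be chosen
    freely, and the last one is y / P, where P is the product of the others and y has the prescribed
    order o.  As the cycles are long, (q - 1) / o is bounded.  Everything thus reduces to finding,
    for large q, an element y of order o = (q - 1) / D such that every y + c_j is a d-th power.

    Let u range over the primes up to about (log q)^2 not dividing q (q - 1).  If t generates F_q^*, so
    does t^u, and t^(D u) has order o.  The number of u for which all t^(D u) + c_j are d-th powers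
    has small variance as t ranges over F_q, while generators have density at least
    1 / (1 + log_2 q); so this number is positive for some generator t.  The first two moments come
    from the equidistribution of the power residue patterns of the polynomials X^(D u) + c_j for one
    or two values of u.  This is proved by Stepanov's method with Hasse derivatives, which only needs
    the auxiliary monomials to be linearly independent over polynomials of degree (log q)^O(1).
    A short dependency modulo X^q is eliminated against its image under an operator: the derivative
    when the characteristic is large, a power of the Frobenius map when it is small.  It is then
    excluded by looking at the order of vanishing at a simple root of one of the polynomials that is
    not a root of the others. *)

Require Import Defs.
From mathcomp Require Import all_boot all_order all_algebra all_fingroup all_solvable all_field.
From mathcomp Require Import reals zify ring.

Set Implicit Arguments.
Unset Strict Implicit.
Unset Printing Implicit Defensive.

Import Order.TTheory GRing.Theory Num.Theory.
Local Open Scope ring_scope.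

(** * Hasse derivatives *)

Section HasseDerivative.
Variable F : fieldType.
Implicit Types (p r f : {poly F}).

(** Encodes p(X + Y) as a polynomial in Y over F[X]; substitution is multiplicative, which gives the
    Leibniz rule for Hasse derivatives. *)
Definition taylor (p : {poly F}) : {poly {poly F}} := \poly_(i < size p) p^`N(i).

Lemma taylorE p : taylor p = (map_poly (polyC \o polyC) p).['X%:P + 'X].
Proof.
rewrite nderiv_taylor; last exact: mulrC.
rewrite (size_map_inj_poly (f := polyC \o polyC)) //; last by move=> x y /polyC_inj/polyC_inj.
rewrite /taylor poly_def; apply: eq_bigr => i _.
rewrite -mul_polyC nderivn_map; congr (_ * _).
rewrite map_poly_comp horner_map /=; congr (_%:P).
elim/poly_ind: (p^`N(i)) => [|q c IH]; first by rewrite map_polyC hornerC.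
by rewrite rmorphD rmorphM /= map_polyX map_polyC /= !hornerE -IH.
Qed.

Lemma coef_taylor p i : (taylor p)`_i = p^`N(i).
Proof. by rewrite coef_poly; case: ltnP => // /nderivn_poly0. Qed.

Lemma nderivnM p r n : (p * r)^`N(n) = \sum_(i < n.+1) p^`N(i) * r^`N(n - i).
Proof.
rewrite -coef_taylor (_ : taylor (p * r) = taylor p * taylor r).
  by rewrite coefM; apply: eq_bigr => i _; rewrite !coef_taylor.
by rewrite !taylorE rmorphM hornerM.
Qed.

(** [phi n] is a guaranteed divisor of the n-th Hasse derivative. Since these divisors only shrink
    as n grows, the Leibniz rule makes the notion stable under products. *)
Definition vanishing (f : {poly F}) (phi : nat -> {poly F}) :=
  (forall n, phi n %| f^`N(n)) /\ (forall m n, (m <= n)%N -> phi n %| phi m).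

Lemma vanishingX p k : vanishing (p ^+ k) (fun n => p ^+ (k - n)).
Proof.
split; last by move=> m n mn; apply: dvdp_exp2l; lia.
elim: k => [|k IH] n; first by rewrite sub0n dvd1p.
rewrite exprS nderivnM; apply: (big_ind (fun x => _ %| x)); first exact: dvdp0.
  by move=> x y; apply: dvdp_add.
move=> i _; case: (posnP i) => [->|i0].
  rewrite nderivn0 subn0; apply: (dvdp_trans (y := p * p ^+ (k - n))).
    by rewrite -exprS; apply: dvdp_exp2l; lia.
  exact/dvdp_mul/IH.
apply: dvdp_mull; apply: dvdp_trans (IH _).
by apply: dvdp_exp2l; have := ltn_ord i; lia.
Qed.

Lemma vanishingM p r phi psi :
  vanishing p phi -> vanishing r psi -> vanishing (p * r) (fun n => phi n * psi n).
Proof.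
move=> [p1 p2] [r1 r2]; split=> [n|m n mn]; last by apply: dvdp_mul; auto.
rewrite nderivnM; apply: (big_ind (fun x => _ %| x)); first exact: dvdp0.
  by move=> x y; apply: dvdp_add.
move=> i _; apply: dvdp_mul.
  by apply: dvdp_trans (p1 i); apply: p2; rewrite -ltnS.
by apply: dvdp_trans (r1 _); apply: r2; rewrite leq_subr.
Qed.

Lemma vanishing_prod (I : finType) (g : I -> {poly F}) (k : I -> nat) :
  vanishing (\prod_i g i ^+ k i) (fun n => \prod_i g i ^+ (k i - n)).
Proof.
elim: (index_enum I) => [|i s [IH1 IH2]].
  split=> [n|m n _]; rewrite ?big_nil ?dvd1p //.
have [H1 H2] := vanishingM (vanishingX (g i) (k i)) (conj IH1 IH2).
by split=> [n|m n mn]; rewrite !big_cons; auto.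
Qed.

Lemma dvdp_nderivnMprod (I : finType) (g : I -> {poly F}) (k : I -> nat) p n :
  \prod_i g i ^+ (k i - n) %| (p * \prod_i g i ^+ k i)^`N(n).
Proof.
have [H1 H2] := vanishing_prod g k.
rewrite nderivnM; apply: (big_ind (fun x => _ %| x)); first exact: dvdp0.
  by move=> x y; apply: dvdp_add.
by move=> i _; apply/dvdp_mull/(dvdp_trans _ (H1 _))/H2; rewrite leq_subr.
Qed.

(** Hasse derivatives at x are the coefficients of the expansion of p in powers of X - x, so they
    detect multiplicity in every characteristic. *)
Lemma dvdp_XsubCX p x m :
  (forall n, (n < m)%N -> root p^`N(n) x) -> ('X - x%:P) ^+ m %| p.
Proof.
move=> H; have -> : p = \sum_(i < size p) (p^`N(i)).[x] *: ('X - x%:P) ^+ i.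
  have := nderiv_taylor (map_poly polyC p) (mulrC x%:P ('X - x%:P)).
  rewrite addrC subrK size_map_polyC -/(comp_poly 'X p) comp_polyXr => {1}->.
  by apply: eq_bigr => i _; rewrite nderivn_map horner_map -mul_polyC.
apply: (big_ind (fun y => _ %| y)); first exact: dvdp0.
  by move=> u v; apply: dvdp_add.
move=> i _; case: (ltnP i m) => im; last by rewrite -mul_polyC dvdp_mull ?dvdp_exp2l.
by rewrite (rootP (H _ im)) scale0r dvdp0.
Qed.

Lemma card_multiple_roots p (Z : seq F) m :
  uniq Z -> p != 0 -> (forall x, x \in Z -> ('X - x%:P) ^+ m %| p) -> (size Z * m < size p)%N.
Proof.
move=> uZ p0 H.
have H1 : (\prod_(x <- Z) ('X - x%:P)) ^+ m %| p.
  elim: Z uZ H => [|x Z IH] /=; first by rewrite big_nil expr1n dvd1p.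
  case/andP=> xZ uZ H; rewrite big_cons exprMn Gauss_dvdp; last first.
    by apply/coprimep_expl/coprimep_expr; rewrite coprimep_sym coprimep_XsubC root_prod_XsubC.
  by rewrite H ?mem_head //= IH // => y yZ; rewrite H // inE yZ orbT.
have := dvdp_leq p0 H1; rewrite [X in (X <= _)%N]polySpred.
  by rewrite size_exp size_prod_XsubC.
by rewrite expf_neq0 // monic_neq0 // monic_prod_XsubC.
Qed.
End HasseDerivative.

(** * Stepanov's method *)

Lemma pchar_poly_nat (F : finFieldType) p f : p \in [pchar F] -> [pchar {poly F}].-nat (p ^ f)%N.
Proof.
move=> pF; rewrite pnatX pnatE ?(pcharf_prime pF) //; apply/orP; left.
exact: (rmorph_pchar polyC pF).
Qed.

Lemma pchar_poly_card (F : finFieldType) : [pchar {poly F}].-nat #|F|.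
Proof.
have [p p_pr pF] := finPcharP F.
by rewrite (card_pprimeChar pF) pchar_poly_nat.
Qed.

Lemma exprB_card (F : finFieldType) (p r : {poly F}) :
  (p - r) ^+ #|F| = p ^+ #|F| - r ^+ #|F|.
Proof.
have H := pchar_poly_card F.
apply/(canRL (addrK _)); rewrite -[RHS]/(p ^+ _).
by rewrite -exprDn_pchar // subrK.
Qed.

Lemma size_nderivn (F : fieldType) (p : {poly F}) n : (size p^`N(n) <= size p)%N.
Proof.
apply/leq_sizeP => j pj; rewrite coef_nderivn nth_default ?mul0rn //.
exact: leq_trans (leq_addl _ _).
Qed.

Section SizeProd.
Variables (F : fieldType) (I : finType) (g : I -> {poly F}).
Hypothesis g0 : forall i, g i != 0.

Lemma prod_exp_neq0 (k : I -> nat) : \prod_i g i ^+ k i != 0.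
Proof. by apply/prodf_neq0 => i _; rewrite expf_neq0. Qed.

Lemma size_prod_exp (k : I -> nat) :
  size (\prod_i g i ^+ k i) = (\sum_i k i * (size (g i)).-1)%N.+1.
Proof.
rewrite size_prod => [|i _]; last by rewrite expf_neq0.
rewrite -sum1_card.
have -> : (\sum_i size (g i ^+ k i) = \sum_i (k i * (size (g i)).-1) + \sum_(i : I) 1)%N.
  rewrite -big_split; apply: eq_bigr => i _ /=.
  by rewrite addn1 mulnC -size_exp -polySpred // expf_neq0.
by rewrite -addSn addnK.
Qed.
End SizeProd.

Section Stepanov.
Variables (F : finFieldType) (I : finType) (d s : nat) (g : I -> {poly F}) (delta : nat).
Local Notation q := #|F|.
Local Notation E := {ffun I -> 'I_d}.
Local Notation Gam := (#|I| * delta)%N.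

(** At a point x with g_i(x)^s = zeta_i for all i, the value of this monomial depends only on e and
    zeta. *)
Definition Wpow (e : {ffun I -> 'I_d}) := \prod_i g i ^+ (e i * s).

Definition independent_upto B := forall r : E -> {poly F},
  (forall e, (size (r e) <= B)%N) -> 'X^q %| \sum_e r e * Wpow e -> forall e, r e = 0.

Hypothesis g0 : forall i, g i != 0.
Hypothesis size_g : forall i, (size (g i) <= delta.+1)%N.

(** The division is exact. For n <= M the divisor still contains [Wpow e], and the degree of what
    remains is bounded independently of s. *)
Definition hasse_quotient M (e : E) n r :=
  (r * \prod_i g i ^+ (e i * s + M))^`N(n) %/ \prod_i g i ^+ (e i * s + M - n).

Lemma hasse_quotientK M e n r :
  hasse_quotient M e n r * \prod_i g i ^+ (e i * s + M - n) =
  (r * \prod_i g i ^+ (e i * s + M))^`N(n).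
Proof. by rewrite divpK // dvdp_nderivnMprod. Qed.

Lemma hasse_quotientB M e n r r' :
  hasse_quotient M e n (r - r') = hasse_quotient M e n r - hasse_quotient M e n r'.
Proof. by rewrite /hasse_quotient mulrBl nderivnB divpD divpN. Qed.

Lemma size_hasse_quotient M e n r : (n <= M)%N ->
  (size (hasse_quotient M e n r) <= size r + n * Gam)%N.
Proof.
move=> nM; rewrite /hasse_quotient size_divp ?prod_exp_neq0 // size_prod_exp //=.
rewrite leq_subLR.
apply: (@leq_trans (size (r * \prod_i g i ^+ (e i * s + M)))).
  exact: size_nderivn.
have [->|r0] := eqVneq r 0; first by rewrite mul0r size_poly0.
rewrite size_mul ?prod_exp_neq0 // size_prod_exp // addnS /= [leqRHS]addnCA leq_add2l.
have -> : (\sum_i (e i * s + M) * (size (g i)).-1 =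
  \sum_i (e i * s + M - n) * (size (g i)).-1 + \sum_i n * (size (g i)).-1)%N.
  by rewrite -big_split; apply: eq_bigr => i _ /=; rewrite -mulnDl; congr (_ * _)%N; lia.
rewrite leq_add2l -big_distrr /= leq_mul2l -sum_nat_const; apply/orP; right.
by apply: leq_sum => i _; case: (size (g i)) (size_g i).
Qed.

(** Terms of index above k are divisible by X^(q(k+1)); once the lower coefficients vanish, block k
    is therefore a short relation modulo X^q. *)
Lemma independent_Xq B K (r : E -> 'I_K -> {poly F}) : independent_upto B ->
  (forall e k, (size (r e k) <= B)%N) ->
  \sum_e \sum_k r e k * 'X^(q * k) * Wpow e = 0 -> forall e k, r e k = 0.
Proof.
move=> ind sr eq0.
suff H : forall n (k : 'I_K), (k < n)%N -> forall e, r e k = 0.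
  by move=> e k; apply: (H k.+1).
elim=> // n IH k; rewrite ltnS leq_eqVlt => /orP[/eqP kn|/IH //].
apply: (ind (r ^~ k)) => //.
have eq1 : 'X^(q * k) * (\sum_e r e k * Wpow e) +
    \sum_e \sum_(j | j != k) r e j * 'X^(q * j) * Wpow e = 0.
  rewrite -[RHS]eq0 mulr_sumr -big_split; apply: eq_bigr => e _ /=.
  rewrite [RHS](bigD1 k) //=; congr (_ + _); ring.
have : 'X^(q * k) * 'X^q %| 'X^(q * k) * (\sum_e r e k * Wpow e).
  move/eqP: eq1; rewrite addr_eq0 => /eqP ->; rewrite dvdpNr.
  apply: (big_ind (fun y => _ %| y)) => [|u v|e _]; [exact: dvdp0|exact: dvdp_add|].
  apply: (big_ind (fun y => _ %| y)) => [|u v|j jk]; [exact: dvdp0|exact: dvdp_add|].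
  have [jn|nj] := ltnP j n; first by rewrite IH // !mul0r dvdp0.
  rewrite -exprD dvdp_mulr // dvdp_mull // dvdp_exp2l //.
  have jk' : (j : nat) != k by [].
  have {}nj : (k < j)%N by rewrite ltn_neqAle eq_sym jk' kn.
  by rewrite -mulnSr leq_mul2l nj orbT.
by rewrite dvdp_mul2l // -size_poly_gt0 size_polyXn.
Qed.

(** Since (X - x)^q = X^q - x, Hasse derivatives of order below q at x cannot tell X^(qk) from the
    constant x^k. *)
Lemma XsubCX_dvd_Xq_sub (x : F) k : ('X - x%:P) ^+ q %| 'X^(q * k) - (x ^+ k)%:P.
Proof.
rewrite exprM rmorphXn /= subrXX dvdp_mulr //.
by rewrite exprB_card -rmorphXn /= expf_card.
Qed.

(** A nonzero auxiliary polynomial [R] vanishing to order M at every point of the pattern is built;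
    its degree bounds their number. Such an [R] exists because there are more free coefficients than
    conditions, and it is nonzero by independence. *)
Lemma stepanov_count B K M (zeta : I -> F) : (0 < d)%N -> (d * s).+1 = q ->
  independent_upto B -> (M <= q)%N ->
  (M * (B + K + M * Gam) < d ^ #|I| * K * B)%N ->
  (#|[set x : F | [forall i, (g i).[x] ^+ s == zeta i]]| * M <= B + Gam * (q + M) + q * K)%N.
Proof.
move=> d0 dsq ind Mq dimlt.
set Z := [set x | _]; pose B' := (B + K + M * Gam)%N.
pose zE (e : E) := \prod_i zeta i ^+ e i.
(* At a point of the pattern, [V n] gives the n-th Hasse derivative of the auxiliary polynomial up
   to a common factor: g_i^s has been replaced by zeta_i and X^(qk) by X^k. Its low degree keeps the
   number of conditions small. *)
pose V n (rho : {ffun E * 'I_K -> 'rV[F]_B}) :=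
  \sum_(u : E * 'I_K) zE u.1 *: ('X^(u.2) * hasse_quotient M u.1 n (rVpoly (rho u))).
pose Phi rho := [ffun n : 'I_M => poly_rV (V n rho) : 'rV[F]_B'].
have sizeV n rho : (n <= M)%N -> (size (V n rho) <= B')%N.
  move=> nM; rewrite (leq_trans (size_sum _ _ _)) //; apply/bigmax_leqP => u _.
  rewrite (leq_trans (size_scale_leq _ _)) // (leq_trans (size_polyMleq _ _)) //.
  rewrite size_polyXn addSn /= /B' addnAC [leqRHS]addnC addnC.
  rewrite addnC leq_add // ?(ltnW (ltn_ord _)) //.
  rewrite (leq_trans (size_hasse_quotient _ _ nM)) // leq_add ?size_poly //.
  by rewrite leq_mul2r nM orbT.
(* Pigeonhole over the finite field replaces linear algebra: the difference of two assignments with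
   equal image solves the homogeneous system. *)
have /injectivePn[rho1 [rho2 rho12 eqPhi]] : ~~ injectiveb Phi.
  apply/negP => /injectiveP /leq_card.
  rewrite !card_ffun !card_mx !mul1n !card_prod !card_ffun !card_ord -!expnM leqNgt => /negP[].
  rewrite ltn_exp2l; last by rewrite -dsq; have := finNzRing_gt1 F; rewrite -dsq.
  by rewrite mulnC [ltnRHS]mulnC.
pose r e k := rVpoly (rho1 (e, k)) - rVpoly (rho2 (e, k)).
have sr e k : (size (r e k) <= B)%N.
  by rewrite (leq_trans (size_polyD _ _)) // geq_max size_polyN !size_poly.
have Vr n : (n < M)%N ->
    \sum_(u : E * 'I_K) zE u.1 *: ('X^(u.2) * hasse_quotient M u.1 n (r u.1 u.2)) = 0.
  move=> nM; have /ffunP/(_ (Ordinal nM)) := eqPhi; rewrite !ffunE => /(congr1 rVpoly).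
  rewrite !poly_rV_K ?sizeV ?(ltnW nM) //= => eqV.
  transitivity (V n rho1 - V n rho2); last by rewrite eqV subrr.
  rewrite -sumrB; apply: eq_bigr => -[e k] _ /=.
  by rewrite hasse_quotientB mulrBr scalerBr.
pose R := \sum_e \sum_k r e k * 'X^(q * k) * \prod_i g i ^+ (e i * s + M).
have RE : R = (\sum_e \sum_k r e k * 'X^(q * k) * Wpow e) * \prod_i g i ^+ M.
  rewrite mulr_suml; apply: eq_bigr => e _; rewrite mulr_suml; apply: eq_bigr => k _.
  rewrite -[RHS]mulrA; congr (_ * _); rewrite /Wpow -big_split; apply: eq_bigr => i _ /=.
  by rewrite exprD.
have R0 : R != 0.
  apply: contra rho12; rewrite RE mulf_eq0 (negPf (prod_exp_neq0 g0 _)) orbF => /eqP H.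
  have {}H := independent_Xq ind sr H.
  apply/eqP/ffunP => -[e k]; apply: (can_inj rVpolyK); apply/eqP.
  by rewrite -subr_eq0 -/(r e k) H.
have sR : (size R <= B + Gam * (q + M) + q * K)%N.
  apply: leq_trans (size_sum _ _ _) _; apply/bigmax_leqP => e _.
  apply: leq_trans (size_sum _ _ _) _; apply/bigmax_leqP => k _.
  apply: leq_trans (size_polyMleq _ _) _; rewrite size_prod_exp // addnS /=.
  rewrite [leqRHS]addnAC leq_add //.
    apply: leq_trans (size_polyMleq _ _) _; rewrite size_polyXn addnS /= leq_add //.
    by rewrite leq_mul2l (ltnW (ltn_ord k)) orbT.
  rewrite -mulnA -sum_nat_const; apply: leq_sum => i _; rewrite mulnC leq_mul //.
    by case: (size (g i)) (size_g i).
  rewrite leq_add2r -dsq mulnC ltnW // ltnS mulnC leq_mul2r.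
  by rewrite (ltnW (ltn_ord (e i))) orbT.
rewrite cardE; apply: ltnW; apply: leq_trans sR; apply: card_multiple_roots => //.
  exact: enum_uniq.
move=> x; rewrite mem_enum inE => /forallP xZ.
(* Here X^(qk) is frozen at x^k; [R - Rx] is divisible by (X - x)^q, and M <= q, so only [Rx] must
   be checked. *)
pose Rx := \sum_(u : E * 'I_K) x ^+ u.2 *: (r u.1 u.2 * \prod_i g i ^+ (u.1 i * s + M)).
have -> : R = Rx + (R - Rx) by rewrite addrC subrK.
apply: dvdp_add; last first.
  apply: dvdp_trans (dvdp_exp2l _ Mq) _.
  rewrite /R pair_bigA /= -sumrB.
  apply: (big_ind (fun y => _ %| y)) => [|u v|[e k] _ /=]; [exact: dvdp0|exact: dvdp_add|].
  rewrite -mul_polyC mulrCA -mulrA -mulrBr -mulrBl mulrC -mulrA dvdp_mulr //.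
  exact: XsubCX_dvd_Xq_sub.
apply: dvdp_XsubCX => n nM; rewrite /Rx rootE.
suff -> : Rx^`N(n).[x] = 
  (\sum_(u : E * 'I_K) zE u.1 *: ('X^(u.2) * hasse_quotient M u.1 n (r u.1 u.2))).[x]
   * \prod_i (g i).[x] ^+ (M - n).
  by rewrite Vr // horner0 mul0r.
rewrite (big_morph _ (nderivnD n) (nderivn_poly0 (p := 0) _)) ?size_poly0 //.
rewrite !horner_sum mulr_suml; apply: eq_bigr => -[e k] _ /=.
rewrite nderivnZ -hasse_quotientK !hornerZ !hornerM hornerXn.
have -> : (\prod_i g i ^+ (e i * s + M - n)).[x] = zE e * \prod_i (g i).[x] ^+ (M - n).
  rewrite horner_prod -big_split; apply: eq_bigr => i _ /=.
  by rewrite horner_exp -addnBA 1?ltnW // exprD mulnC exprM (eqP (xZ i)).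
ring.
Qed.
End Stepanov.

(** * Linear independence of the auxiliary monomials *)

Section Elimination.
Variables (F : fieldType) (E : finType) (W : E -> {poly F}).
Variables (theta : E -> {poly F} -> {poly F}) (h : nat -> nat) (bmax T : nat).
Hypothesis W0 : forall e, ~~ root (W e) 0.
Hypothesis h_ge : forall b, (b <= h b)%N.
Hypothesis theta0 : forall e, theta e 0 = 0.
Hypothesis theta_dvd : forall t (r : E -> {poly F}), (t < T)%N ->
  'X^(t.+1) %| \sum_e r e * W e -> 'X^t %| \sum_e theta e (r e) * W e.
Hypothesis size_theta : forall b e (r r' : {poly F}),
  (size r <= b)%N -> (size r' <= b)%N -> (size (theta e r * r')%R <= h b)%N.
Hypothesis theta_inj : forall e e' (r r' : {poly F}), r != 0 -> r' != 0 ->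
  (size r <= bmax)%N -> (size r' <= bmax)%N ->
  theta e r * r' = theta e' r' * r -> e = e'.

(* Combining a relation with its image under theta kills one term and keeps the degrees small. *)
Lemma elimination m b t (r : E -> {poly F}) :
  (iter m h b <= bmax)%N -> (iter m h b + m <= t)%N -> (t <= T)%N ->
  (#|[set e | (r e != 0)%R]| <= m)%N -> (forall e, (size (r e) <= b)%N) ->
  'X^t %| \sum_e r e * W e -> forall e, r e = 0.
Proof.
elim: m b t r => [|m IH] b t r hbmax hbt tT supp sr dvd e0.
  apply/eqP; move: supp; rewrite leqn0 cards_eq0 => /eqP/setP/(_ e0).
  by rewrite !inE => /negbFE.
apply/eqP/contraT => re0.
case: t hbt tT dvd => [|t] hbt tT dvd; first by rewrite addnS ltn0 in hbt.
have hb : (b <= iter m.+1 h b)%N.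
  by elim: (m.+1) => //= k IHk; apply: leq_trans IHk (h_ge _).
(* The term at [e0] cancels, so the support shrinks, at the price of one power of X and of growing
   the degrees by [h]. *)
pose r' e := theta e (r e) * r e0 - theta e0 (r e0) * r e.
have r'0 e : r' e = 0.
  apply: (IH (h b) t r'); rewrite -?iterSr //.
  - by move: hbt; rewrite addnS ltnS.
  - exact: ltnW.
  - rewrite -ltnS (leq_trans _ supp) // proper_card //; apply/properP; split.
      apply/subsetP => e'; rewrite !inE; apply: contra => /eqP re.
      by rewrite /r' re theta0 mul0r mulr0 subrr.
    by exists e0; rewrite inE // /r' subrr eqxx.
  - move=> e'; rewrite (leq_trans (size_polyD _ _)) // size_polyN geq_max.
    by rewrite !size_theta.
  have -> : \sum_e r' e * W e = r e0 * (\sum_e theta e (r e) * W e)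
      - theta e0 (r e0) * (\sum_e r e * W e).
    rewrite !mulr_sumr -sumrB; apply: eq_bigr => e' _; rewrite /r'; ring.
  apply: dvdp_add; first by rewrite dvdp_mull // theta_dvd.
  rewrite dvdpNr dvdp_mull // (dvdp_trans _ dvd) // dvdp_exp2l //.
(* By [theta_inj] only [e0] can remain in the support; a single term [r e0 * W e0] is then too short
   to be divisible by X^t, as [W e0] does not vanish at 0. *)
have r0 e : e != e0 -> r e = 0.
  move=> ee; apply/eqP/contraT => re.
  move/eqP: (r'0 e); rewrite subr_eq0 => /eqP/theta_inj H.
  by rewrite H ?eqxx // in ee; apply: leq_trans (sr _) (leq_trans hb hbmax).
move: dvd; rewrite (bigD1 e0) //= big1 => [|e ee]; last by rewrite r0 // mul0r.
rewrite addr0 Gauss_dvdpl; last first.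
  by apply: coprimep_expl; rewrite coprimep_sym coprimepX.
move/(dvdp_leq re0); rewrite size_polyXn => H.
have := leq_trans H (leq_trans (sr e0) hb).
by rewrite ltnNge (leq_trans _ hbt) // leqNgt; lia.
Qed.
End Elimination.

Lemma size_prod_exp_leq (F : fieldType) (I : finType) (g : I -> {poly F}) delta (k : I -> nat) c :
  (forall i, g i != 0) -> (forall i, (size (g i) <= delta.+1)%N) -> (forall i, (k i <= c)%N) ->
  (size (\prod_i g i ^+ k i)%R <= (c * (#|I| * delta)).+1)%N.
Proof.
move=> g0 sg kc; rewrite size_prod_exp // ltnS mulnCA -sum_nat_const leq_sum // => i _.
by rewrite leq_mul //; case: (size (g i)) (sg i).
Qed.

Lemma natr_pchar_inj (K : fieldType) p a b : p \in [pchar K] ->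
  (a < p)%N -> (b < p)%N -> a%:R = b%:R :> K -> a = b.
Proof.
move=> pK; wlog ab : a b / (a <= b)%N.
  by move=> H ap bp eqab; case: (leqP a b) => [|/ltnW] /H; [|move=> /(_ bp ap (esym eqab))]; auto.
move=> ap bp eqab; have : (b - a)%:R = 0 :> K by rewrite natrB // eqab subrr.
by move/eqP; rewrite -(dvdn_pcharf pK) /dvdn modn_small; lia.
Qed.

Lemma natr_card0 (F : finFieldType) : #|F|%:R = 0 :> F.
Proof.
have [p _ pF] := finPcharP F.
have := finNzRing_gt1 F; rewrite (card_pprimeChar pF); set k := (X in (p ^ X)%N).
by case: k => // k _; rewrite natrX (pcharf0 pF) expr0n.
Qed.

(** The hypothesis says that a'/a = b'/b, and the residue of a logarithmic derivative at x is the
    multiplicity of x, read in K. *)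
Lemma mup_Wronskian (K : fieldType) (x : K) (a b : {poly K}) :
  a != 0 -> b != 0 -> a^`() * b = b^`() * a -> (mup x a)%:R = (mup x b)%:R :> K.
Proof.
move=> a0 b0 eq_ab.
have [m [A]] := multiplicity_XsubC a x; rewrite a0 /= => rA Ea.
have [n [B]] := multiplicity_XsubC b x; rewrite b0 /= => rB Eb.
have mE (p : {poly K}) k : ~~ root p x -> mup x (p * ('X - x%:P) ^+ k) = k.
  by move=> rp; rewrite mupMr // mup_XsubCX eqxx.
have dE (p : {poly K}) k : ('X - x%:P) * (p * ('X - x%:P) ^+ k)^`() =
    (('X - x%:P) * p^`() + p *+ k) * ('X - x%:P) ^+ k.
  case: k => [|k]; first by rewrite !expr0 !mulr1 mulr0n addr0.
  by rewrite derivM deriv_exp derivXsubC mul1r /= exprS -[_ ^+ k *+ _]mulr_natr -[p *+ _]mulr_natr; ring.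
have : (('X - x%:P) * A^`() + A *+ m) * B * ('X - x%:P) ^+ (m + n) =
       (('X - x%:P) * B^`() + B *+ n) * A * ('X - x%:P) ^+ (m + n).
  transitivity (('X - x%:P) * (a^`() * b)).
    rewrite mulrA {1}Ea dE Eb exprD; ring.
  by rewrite eq_ab mulrA {1}Eb dE Ea exprD; ring.
have X0 : ('X - x%:P) ^+ (m + n) != 0 by rewrite expf_neq0 // polyXsubC_eq0.
move/(mulIf X0)/(congr1 (fun p => p.[x])); rewrite Ea Eb !mE //.
rewrite !hornerM !hornerD !hornerM !hornerMn hornerXsubC subrr !mul0r !add0r.
rewrite -mulr_natl -[X in _ = X * _]mulr_natl -!mulrA [A.[x] * _]mulrC.
by apply: mulIf; rewrite mulf_neq0.
Qed.

(** * Excluding short relations, in large and in small characteristic *)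

Section Independence.
Variables (F : finFieldType) (I : finType) (d s : nat) (g : I -> {poly F}) (delta : nat).
Variables (K : fieldType) (phi : {rmorphism F -> K}) (beta : I -> K).
Local Notation q := #|F|.
Local Notation E := {ffun I -> 'I_d}.
Local Notation Gam := (#|I| * delta)%N.
Local Notation v i p := (mup (beta i) (map_poly phi p)).
Local Notation W := (@Wpow F I d s g).

Hypothesis d0 : (0 < d)%N.
Hypothesis dsq : (d * s).+1 = q.
Hypothesis g_at0 : forall i, ~~ root (g i) 0.
Hypothesis size_g : forall i, (size (g i) <= delta.+1)%N.
Hypothesis beta_simple : forall i, v i (g i) = 1%N.
Hypothesis beta_private : forall i k, k != i -> ~~ root (map_poly phi (g k)) (beta i).

Lemma root0_neq0 i : g i != 0.
Proof. by apply: contra (g_at0 i) => /eqP ->; rewrite root0. Qed.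
Let g0 := root0_neq0.

Lemma mup_mapM i (p r : {poly F}) : p != 0 -> r != 0 -> v i (p * r) = (v i p + v i r)%N.
Proof. by move=> p0 r0; rewrite rmorphM mupM // map_poly_eq0. Qed.

Lemma mup_mapX i (p : {poly F}) k : p != 0 -> v i (p ^+ k) = (k * v i p)%N.
Proof.
move=> p0; elim: k => [|k IH]; first by rewrite rmorph1 mupNroot // root1.
by rewrite exprS mup_mapM ?expf_neq0 // IH mulSn.
Qed.

(** At [beta i] only [g i] vanishes, and only simply, so the multiplicity there reads off the
    exponent of [g i]. *)
Lemma mup_map_prod i (k : I -> nat) : v i (\prod_j g j ^+ k j) = k i.
Proof.
rewrite (bigD1 i) //= mup_mapM ?expf_neq0 //; last by apply/prodf_neq0 => j _; rewrite expf_neq0.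
rewrite mup_mapX // beta_simple muln1 mupNroot ?addn0 // rmorph_prod.
rewrite /root horner_prod; apply/prodf_neq0 => j ji.
by rewrite rmorphXn horner_exp expf_neq0 // beta_private.
Qed.

Lemma mup_mapC i (c : F) : c != 0 -> v i c%:P = 0%N.
Proof. by move=> c0; rewrite map_polyC mupNroot // rootC fmorph_eq0. Qed.

Lemma Wpow_at0 e : ~~ root (W e) 0.
Proof.
rewrite /root horner_prod; apply/prodf_neq0 => i _.
by rewrite horner_exp expf_neq0 // g_at0.
Qed.

Lemma card_supp (r : E -> {poly F}) : (#|[set e | (r e != 0)%R]| <= d ^ #|I|)%N.
Proof. by rewrite (leq_trans (max_card _)) // card_ffun card_ord. Qed.

(** Chosen so that [theta_deriv e r * W e] is the derivative of r W_e times the product of all g_i;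
    the image of a relation is thus a derivative, which costs one power of X. *)
Definition theta_deriv (e : E) (r : {poly F}) := hasse_quotient s g 1 e 1 r.

(** If theta does not separate r1 W_e from r2 W_e', their multiplicities v1 + e_i s and v2 + e'_i s
    at [beta i] agree modulo p. Multiplying by d, where d s = -1 modulo p, gives d v1 + e'_i = d v2
    + e_i modulo p. Both sides are below p, so this holds over the integers, and reduction modulo d
    gives e_i = e'_i. *)
Lemma independent_large_char p B : p \in [pchar F] ->
  (d * 2 ^ (d ^ #|I|) * (B + Gam) + d < p)%N ->
  (2 ^ (d ^ #|I|) * (B + Gam) + d ^ #|I| <= q)%N ->
  independent_upto d s g B.
Proof.
move=> pF ltp leq r sr dvd; set m := (d ^ #|I|)%N in ltp leq.
pose h b := (b + Gam + b)%N.
have iterh k : (iter k h B + Gam = 2 ^ k * (B + Gam))%N.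
  elim: k => [|k IH]; first by rewrite mul1n.
  by rewrite iterS {1}/h expnS -mulnA -IH; lia.
have bound : (iter m h B <= 2 ^ m * (B + Gam))%N by rewrite -iterh leq_addr.
apply: (@elimination F E W theta_deriv h (2 ^ m * (B + Gam)) q _ _ _ _ _ _ m B q) => //.
- exact: Wpow_at0.
- by move=> b; rewrite /h leq_addl.
- by move=> e; rewrite /theta_deriv /hasse_quotient mul0r nderivn_poly0 ?size_poly0 // div0p.
- move=> t r' _ H.
  have -> : \sum_e theta_deriv e (r' e) * W e = ((\sum_e r' e * W e) * \prod_i g i)^`().
    rewrite mulr_suml raddf_sum; apply: eq_bigr => e _.
    rewrite /= -nderivn1 -mulrA -big_split /=.
    under [in RHS]eq_bigr do rewrite -exprSr -addn1.
    rewrite -hasse_quotientK; congr (_ * _).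
    by apply: eq_bigr => i _; rewrite addnK.
  case/dvdpP: (dvdp_mulr (\prod_i g i) H) => c ->.
  rewrite derivM derivXn dvdp_add //; first by rewrite dvdp_mull // dvdp_exp2l.
  by rewrite dvdp_mull // -mulr_natl dvdp_mull.
- move=> b e r1 r2 s1 s2; apply: leq_trans (size_polyMleq _ _) _.
  apply: leq_trans (leq_pred _) _; rewrite leq_add //.
  apply: leq_trans (size_hasse_quotient s g0 size_g e r1 (leqnn 1)) _.
  by rewrite mul1n leq_add2r.
- move=> e e' r1 r2 r10 r20 s1 s2 eqth; apply/ffunP => i.
  pose a1 := r1 * \prod_i g i ^+ (e i * s + 1).
  pose a2 := r2 * \prod_i g i ^+ (e' i * s + 1).
  have P0 (k : I -> nat) : \prod_i g i ^+ k i != 0 := prod_exp_neq0 g0 k.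
  have dth (f : E) (r0 : {poly F}) : (r0 * \prod_i g i ^+ (f i * s + 1))^`() = theta_deriv f r0 * W f.
    rewrite -nderivn1 -hasse_quotientK; congr (_ * _).
    by apply: eq_bigr => j _; rewrite addnK.
  have PW (f : E) : \prod_i g i ^+ (f i * s + 1) = W f * \prod_i g i.
    by rewrite -big_split; apply: eq_bigr => j _; rewrite exprD.
  have eqd : a1^`() * a2 = a2^`() * a1.
    rewrite /a1 /a2 !dth !PW.
    transitivity ((theta_deriv e r1 * r2) * (W e * W e' * \prod_i g i)); first by ring.
    by rewrite eqth; ring.
  have := @mup_Wronskian K (beta i) (map_poly phi a1) (map_poly phi a2).
  rewrite !map_poly_eq0 !mulf_neq0 // => /(_ isT isT).
  rewrite !deriv_map -!rmorphM eqd => /(_ erefl).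
  rewrite !mup_mapM // !mup_map_prod => eqv.
  have vle (r0 : {poly F}) : r0 != 0 -> (size r0 <= 2 ^ m * (B + Gam))%N -> (d * v i r0 + d < p)%N.
    move=> r00 sr0; apply: leq_ltn_trans ltp; rewrite leq_add2r -mulnA leq_mul2l.
    apply/orP; right; apply: leq_trans sr0.
    have := mup_geq (beta i) (v i r0) (q := map_poly phi r0); rewrite map_poly_eq0 => /(_ r00).
    rewrite leqnn => /esym/dvdp_leq; rewrite map_poly_eq0 => /(_ r00).
    by rewrite size_exp_XsubC size_map_poly; apply: ltnW.
  have := vle _ r10 s1; have := vle _ r20 s2; have := ltn_ord (e i); have := ltn_ord (e' i).
  move: eqv; set v1 := v i r1; set v2 := v i r2 => eqv e'd ed v2p v1p.
  have pK : p \in [pchar K] by exact: (rmorph_pchar phi pF).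
  have q0 : q%:R = 0 :> K by rewrite -(rmorph_nat phi) natr_card0 rmorph0.
  have eqn : (d * v1 + e' i = d * v2 + e i)%N.
    apply: (natr_pchar_inj pK); [lia | lia | ].
    have {}eqv : (d * (v1 + (e i * s + 1)) + e i + e' i)%:R =
                 (d * (v2 + (e' i * s + 1)) + e i + e' i)%:R :> K.
      have H : (d * (v1 + (e i * s + 1)))%:R = (d * (v2 + (e' i * s + 1)))%:R :> K.
        by rewrite natrM eqv -natrM.
      by rewrite natrD [in LHS]natrD H -!natrD.
    have modq x y z : (d * (x + (y * s + 1)) + y + z)%:R = (d * x + z)%:R + d%:R :> K.
      rewrite (_ : (_ + _ = y * (d * s).+1 + ((d * x + z) + d))%N); last by lia.
      by rewrite dsq natrD natrM q0 mulr0 add0r natrD.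
    apply: (@addIr _ d%:R); rewrite -(modq _ (e i)) eqv addnAC modq //.
  have := congr1 (modn^~ d) eqn; rewrite /= !(mulnC d) !modnMDl !modn_small //.
  by move=> eqi; apply: val_inj.
- by rewrite (leq_trans _ leq) // leq_add2r.
- exact: card_supp.
Qed.

Lemma Xq_dvd_Frobenius i k : 'X^q %| (g i ^+ q) ^+ k - (((g i).[0]) ^+ k)%:P.
Proof.
rewrite rmorphXn /= subrXX dvdp_mulr //.
have -> : g i ^+ q - (g i).[0]%:P = (g i - (g i).[0]%:P) ^+ q.
  by rewrite exprB_card -rmorphXn /= expf_card.
apply: dvdp_exp2r; rewrite -['X]subr0 -polyC0 dvdp_XsubCl /root.
by rewrite !hornerE subrr.
Qed.

(** With Q = d w + 1 a power of the characteristic, this comes from the Q-th power of r W_e times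
    the product of the g_i^(d w). There g_i has exponent e_i s + (d - e_i) w + q e_i w, and g_i^q is
    congruent to g_i(0) modulo X^q. *)
Definition theta_Frob w (e : E) (r : {poly F}) :=
  r ^+ (d * w).+1 *
  ((\prod_i (g i).[0] ^+ (e i * w))%:P * \prod_i g i ^+ ((d - e i) * w)).

Lemma theta_Frob_cong w e r : [pchar {poly F}].-nat (d * w).+1 ->
  'X^q %| (r * W e) ^+ (d * w).+1 * \prod_i g i ^+ (d * w) - theta_Frob w e r * W e.
Proof.
move=> Qnat.
have -> : (r * W e) ^+ (d * w).+1 * \prod_i g i ^+ (d * w) - theta_Frob w e r * W e =
  r ^+ (d * w).+1 * W e * \prod_i g i ^+ ((d - e i) * w) *
   (\prod_i (g i ^+ q) ^+ (e i * w) - \prod_i ((g i).[0] ^+ (e i * w))%:P).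
  rewrite /theta_Frob rmorph_prod mulrBr; congr (_ - _); last by ring.
  rewrite exprMn -!mulrA; congr (_ * _).
  rewrite /Wpow -prodrXl -!big_split; apply: eq_bigr => i _ /=.
  rewrite -!exprM -!exprD; congr (_ ^+ _); rewrite -dsq.
  by have := ltn_ord (e i); nia.
apply: dvdp_mull; apply: (big_ind2 (fun x y => 'X^q %| x - y)).
- by rewrite subrr dvdp0.
- move=> x y x' y' H H'.
  have -> : x * x' - y * y' = (x - y) * x' + y * (x' - y') by ring.
  by apply: dvdp_add; [apply: dvdp_mulr | apply: dvdp_mull].
- by move=> i _; apply: Xq_dvd_Frobenius.
Qed.

(** Comparing multiplicities at [beta i] gives w (d v1 + e'_i) = w (d v2 + e_i), directly over the
    integers, hence e_i = e'_i modulo d. The degrees grow by a factor of about d w at each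
    elimination, so d w has to be small. *)
Lemma independent_small_char w B : (0 < w)%N -> [pchar {poly F}].-nat (d * w).+1 ->
  ((d * w + 3) ^ (d ^ #|I|) * (B + Gam) + d ^ #|I| < q)%N ->
  independent_upto d s g B.
Proof.
move=> w0 Qnat leq r sr dvd; set m := (d ^ #|I|)%N in leq.
pose h b := ((d * w).+1 * b + d * w * Gam + b)%N.
have iterh k : (iter k h B + Gam <= (d * w + 3) ^ k * (B + Gam))%N.
  elim: k => [|k IH]; first by rewrite mul1n.
  rewrite iterS {1}/h expnS -[leqRHS]mulnA.
  apply: leq_trans (leq_mul (leqnn (d * w + 3)%N) IH).
  by move: (d * w)%N (iter k h B) => a x; nia.
have bound : (iter m h B <= (d * w + 3) ^ m * (B + Gam))%N.
  exact: leq_trans (leq_addr _ _) (iterh _).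
apply: (@elimination F E W (theta_Frob w) h (iter m h B) q.-1 _ _ _ _ _ _ m B q.-1) => //.
- exact: Wpow_at0.
- by move=> b; rewrite /h leq_addl.
- by move=> e; rewrite /theta_Frob expr0n mul0r.
- move=> t r' tT H.
  have tq : (t <= q)%N by rewrite -dsq /= in tT *; lia.
  have -> : \sum_e theta_Frob w e (r' e) * W e =
      (\sum_e r' e * W e) ^+ (d * w).+1 * \prod_i g i ^+ (d * w)
      - \sum_e ((r' e * W e) ^+ (d * w).+1 * \prod_i g i ^+ (d * w) - theta_Frob w e (r' e) * W e).
    rewrite sumrB -mulr_suml.
    suff <- : (\sum_e r' e * W e) ^+ (d * w).+1 = \sum_e (r' e * W e) ^+ (d * w).+1 by ring.
    apply: (big_morph (fun p => p ^+ (d * w).+1)); last by rewrite expr0n.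
    by move=> x y; apply: exprDn_pchar.
  apply: dvdp_add.
    rewrite dvdp_mulr // exprS dvdp_mulr // (dvdp_trans _ H) // dvdp_exp2l //.
  rewrite dvdpNr; apply: (big_ind (fun y => _ %| y)) => [|u v|e _]; [exact: dvdp0|exact: dvdp_add|].
  exact: dvdp_trans (dvdp_exp2l _ tq) (theta_Frob_cong _ _ Qnat).
- move=> b e r1 r2 s1 s2.
  have [->|r10] := eqVneq r1 0; first by rewrite /theta_Frob expr0n !mul0r size_poly0.
  apply: leq_trans (size_polyMleq _ _) _.
  apply: leq_trans (leq_pred _) _; rewrite leq_add //.
  apply: leq_trans (size_polyMleq _ _) _.
  have S1 : (size (r1 ^+ (d * w).+1)%R <= (d * w).+1 * b)%N.
    apply: leq_trans (size_poly_exp_leq _ _) _.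
    by move: s1; rewrite -size_poly_gt0 in r10; case: (size r1) r10 => // k _; nia.
  have S2 : (size ((\prod_i (g i).[0] ^+ (e i * w))%:P * \prod_i g i ^+ ((d - e i) * w))%R
       <= (d * w * Gam).+1)%N.
    rewrite mul_polyC (leq_trans (size_scale_leq _ _)) // size_prod_exp_leq // => i.
    by rewrite leq_mul2r leq_subr orbT.
  by rewrite -[leqRHS]/(_.+1.-1) -addnS -!subn1 leq_sub2r // leq_add.
- move=> e e' r1 r2 r10 r20 s1 s2 eqth; apply/ffunP => i.
  have P0 (k : I -> nat) : \prod_i g i ^+ k i != 0 := prod_exp_neq0 g0 k.
  have C0 (f : E) : \prod_i (g i).[0] ^+ (f i * w) != 0.
    by apply/prodf_neq0 => j _; rewrite expf_neq0 // g_at0.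
  have vth (f : E) (r0 : {poly F}) : r0 != 0 ->
      v i (theta_Frob w f r0) = ((d * w).+1 * v i r0 + (d - f i) * w)%N /\ theta_Frob w f r0 != 0.
    move=> r00; have Cp : (\prod_i (g i).[0] ^+ (f i * w))%:P != 0 :> {poly F} by rewrite polyC_eq0.
    split; last by rewrite /theta_Frob !mulf_neq0 ?expf_neq0.
    by rewrite /theta_Frob !mup_mapM ?mulf_neq0 ?expf_neq0 // mup_mapX // mup_mapC // mup_map_prod.
  have [v1 t1] := vth e r1 r10; have [v2 t2] := vth e' r2 r20.
  have := congr1 (fun p => v i p) eqth; rewrite (mup_mapM i t1 r20) (mup_mapM i t2 r10) v1 v2.
  have := ltn_ord (e i); have := ltn_ord (e' i).
  move: (v i r1) (v i r2) => x y e'd ed eqn.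
  have {}eqn : (w * (d * x + e' i) = w * (d * y + e i))%N.
    move: eqn (leq_mul (ltnW ed) (leqnn w)) (leq_mul (ltnW e'd) (leqnn w)).
    rewrite !mulnBl !mulnDr !mulSn !mulnA (mulnC w d) (mulnC w (e' i)) (mulnC w (e i)).
    by move: (d * w * x)%N (d * w * y)%N (d * w)%N (e i * w)%N (e' i * w)%N; lia.
  move/eqP: eqn; rewrite eqn_pmul2l // => /eqP/(congr1 (modn^~ d)).
  rewrite !(mulnC d) !modnMDl !modn_small // => eqi; exact: val_inj.
- by rewrite (leq_trans _ (_ : (d * w + 3) ^ m * (B + Gam) + m <= q.-1)%N) ?leq_add2r //; lia.
- exact: card_supp.
- by rewrite (dvdp_trans _ dvd) // dvdp_exp2l // leq_pred.
Qed.
End Independence.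

(** * Equidistribution of power residue patterns *)

Record private_roots (F : finFieldType) (I : finType) (g : I -> {poly F})
    (K : fieldType) (phi : {rmorphism F -> K}) (beta : I -> K) : Prop := PrivateRoots {
  nonzero_at0 : forall i, ~~ root (g i) 0;
  private_simple : forall i, mup (beta i) (map_poly phi (g i)) = 1%N;
  private_only : forall i k, k != i -> ~~ root (map_poly phi (g k)) (beta i) }.

(** The derivative serves when p exceeds a bound of order Y, the Frobenius map otherwise. One
    constant [kappa] acts both as factor and as exponent. *)
Lemma independence d N : (0 < d)%N -> exists kappa, forall (F : finFieldType) (I : finType) s
    (g : I -> {poly F}) delta (K : fieldType) (phi : {rmorphism F -> K}) (beta : I -> K),
  #|I| = N -> (d * s).+1 = #|F| -> private_roots g phi beta ->
  (forall i, (size (g i) <= delta.+1)%N) ->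
  forall B Y, (B + N * delta <= Y)%N -> (0 < Y)%N -> ((kappa * Y) ^ kappa <= #|F|)%N ->
  independent_upto d s g B.
Proof.
move=> d0; pose m := (d ^ N)%N; pose c := (d * 2 ^ m + d)%N.
have m0 : (0 < m)%N by rewrite expn_gt0 d0.
have c0 : (0 < c)%N by rewrite addn_gt0 d0 orbT.
(* As p is prime to d, Euler's theorem makes p^f = d w + 1 for some w; f depends on d only, so p^f
   stays polynomial in Y. *)
pose f := totient d; have f0 : (0 < f)%N by rewrite totient_gt0.
exists (3 * c + m + f * m + 3)%N; set kappa := (_ + 3)%N.
move=> F I s g delta K phi beta cardI dsq [g0 simple private] sg B Y BY Y0 kq.
have [p p_pr pF] := finPcharP F.
have kY : (kappa * Y <= #|F|)%N.
  apply: leq_trans kq; apply: (@leq_pexp2l (kappa * Y) 1); first by rewrite muln_gt0 Y0 addn_gt0 orbT.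
  by rewrite /kappa addn_gt0 orbT.
have c2m : (2 ^ m <= c)%N by rewrite /c (leq_trans (leq_pmull _ d0)) // leq_addr.
have [ltp|lep] := ltnP (d * 2 ^ m * (B + N * delta) + d)%N p.
  apply: (independent_large_char d0 dsq g0 sg simple private pF); rewrite cardI //.
  apply: leq_trans kY; apply: (@leq_trans (c * Y + m * Y)).
    by rewrite leq_add ?leq_mul ?leq_pmulr.
  by rewrite -mulnDl leq_mul2r /kappa; lia.
have lepc : (p <= c * Y)%N.
  apply: leq_trans lep _; rewrite /c mulnDl leq_add ?leq_pmulr //.
  by rewrite leq_mul2l BY orbT.
have cop : coprime p d.
  rewrite prime_coprime //; apply/negP => pd.
  have : (p %| 1)%N.
    have pq : (p %| #|F|)%N by rewrite (dvdn_pcharf pF) natr_card0.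
    by move: pq; rewrite -dsq -addn1 dvdn_addr // dvdn_mulr.
  by rewrite dvdn1; case: (p) p_pr => [|[]].
have pf1 : (1 < p ^ f)%N by rewrite -(exp1n f) ltn_exp2r // prime_gt1.
have dpf : (d %| (p ^ f - 1))%N.
  by rewrite -eqn_mod_dvd ?(ltnW pf1) //; apply/eqP; exact: Euler_exp_totient.
pose w := ((p ^ f - 1) %/ d)%N.
have dw : (d * w = p ^ f - 1)%N by rewrite mulnC divnK.
have Q : ((d * w).+1 = p ^ f)%N by rewrite dw -addn1 subnK // ltnW.
have w0 : (0 < w)%N by have : (0 < d * w)%N; [lia | rewrite muln_gt0 => /andP[]].
apply: (independent_small_char d0 dsq g0 sg simple private w0); first by rewrite Q pchar_poly_nat.
rewrite cardI.
apply: leq_trans kq; rewrite -/m.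
have h1 : (d * w + 3 <= (kappa * Y) ^ f)%N.
  apply: (@leq_trans ((3 * c * Y) ^ f)); last first.
    by rewrite leq_exp2r // leq_mul2r /kappa; lia.
  rewrite -mulnA expnMn; apply: (@leq_trans (3 * p ^ f)); first by lia.
  by apply: leq_mul; [apply: (@leq_pexp2l 3 1) | rewrite leq_exp2r].
have h2 : ((d * w + 3) ^ m <= (kappa * Y) ^ (f * m))%N by rewrite expnM leq_exp2r.

apply: (@leq_trans ((kappa * Y) ^ (f * m).+1)); last first.
  rewrite leq_pexp2l // ?muln_gt0 ?Y0 /kappa ?addn_gt0 ?orbT //.
  by move: (f * m)%N (3 * c)%N; lia.
have Ym : (Y + m < kappa * Y)%N.
  apply: (@leq_trans ((m + 3) * Y)); last by rewrite leq_mul2r /kappa; apply/orP; right; lia.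
  by rewrite mulnDl; have := leq_pmulr m Y0; lia.
have A0 : (0 < (kappa * Y) ^ (f * m))%N by rewrite expn_gt0 (leq_ltn_trans _ Ym).
rewrite expnS; apply: (@leq_trans ((Y + m).+1 * (kappa * Y) ^ (f * m))); last by rewrite leq_mul2r Ym orbT.
have := leq_mul h2 BY; move: A0; move: (_ ^ (f * m))%N (_ * (_ + _))%N => A b A0 bA.
by rewrite mulSn mulnDl; have := leq_pmulr m A0; lia.
Qed.

Definition pattern_set (F : finFieldType) (I : finType) (s : nat) (g : I -> {poly F}) (zeta : I -> F) :=
  [set x : F | [forall i, (g i).[x] ^+ s == zeta i]].

Lemma stepanov_bound d N : (0 < d)%N -> exists kappa, forall (F : finFieldType) (I : finType) s
    (g : I -> {poly F}) delta lam (K : fieldType) (phi : {rmorphism F -> K}) (beta : I -> K),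
  #|I| = N -> (d * s).+1 = #|F| -> private_roots g phi beta ->
  (forall i, (size (g i) <= delta.+1)%N) -> (0 < lam)%N ->
  ((kappa * (delta + lam)) ^ kappa <= #|F|)%N ->
  forall zeta, (d ^ N * #|pattern_set s g zeta| * lam <= #|F| * lam.+1)%N.
Proof.
move=> d0; have [kap0 ind] := independence N d0; pose P := (d ^ N)%N.
have P0 : (0 < P)%N by rewrite expn_gt0 d0.
pose c := ((N + 3) ^ 2 * (1 + P * N) + N * P * (N + 2) + P * (N + 2) + N)%N.
exists (kap0 * c + c + 5 * kap0 + 5)%N; set kappa := (_ + 5)%N.
move=> F I s g delta lam K phi beta cardI dsq priv sg lam0 kq zeta.
set u := (delta + lam)%N in kq; have u0 : (0 < u)%N by rewrite addn_gt0 lam0 orbT.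
have ule (n : nat) : (u <= u ^ n.+1)%N by apply: (@leq_pexp2l u 1).
(* [M] is slightly below P k and [B] is large, so the P k B coefficients outnumber the conditions.
   As [B + Gam * M] is at most q, the count times P (Gam + 2) lam is at most q (Gam + 2 + kap),
   which is q (Gam + 2) (lam + 1). *)
pose Gam := (N * delta)%N; pose kap := ((Gam + 2) * lam)%N; pose k := kap.+1.
pose B := (k ^ 2 * (1 + P * Gam))%N; pose M := (P * kap)%N.
have G2 : (Gam + 2 <= (N + 2) * u)%N.
  by rewrite mulnDl leq_add ?leq_mul ?leq_addr // leq_pmulr.
have kapu : (kap <= (N + 2) * u ^ 2)%N.
  by rewrite -mulnn mulnA leq_mul // leq_addl.
have ku : (k <= (N + 3) * u ^ 2)%N by rewrite /k -addn1 (addnA N 2 1) mulnDl leq_add // mul1n expn_gt0 u0.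
have Bu : (B <= (N + 3) ^ 2 * (1 + P * N) * u ^ 5)%N.
  rewrite (_ : u ^ 5 = u ^ 2 * u ^ 2 * u)%N; last by ring.
  apply: (@leq_trans (((N + 3) * u ^ 2) ^ 2 * ((1 + P * N) * u))); last by apply: eq_leq; ring.
  rewrite leq_mul ?leq_exp2r // mulnDl mul1n leq_add // -mulnA leq_mul // leq_mul // leq_addr //.
have Y5 : (B + Gam * M + M + Gam <= c * u ^ 5)%N.
  rewrite /c !mulnDl !leq_add //.
  - rewrite (_ : N * P * (N + 2) * u ^ 5 = N * u ^ 3 * (P * ((N + 2) * u ^ 2)))%N; last by ring.
    apply: leq_mul; last by rewrite /M leq_mul.
    by rewrite /Gam leq_mul // (leq_trans _ (ule 2%N)) // leq_addr.
  - by rewrite -[leqRHS]mulnA leq_mul // (leq_trans kapu) // leq_mul // leq_pexp2l.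
  - by rewrite /Gam leq_mul // (leq_trans _ (ule 4%N)) // leq_addr.
pose Y := (B + Gam * M + M + Gam)%N.
have B0 : (0 < B)%N by rewrite /B muln_gt0 expn_gt0.
have Y0 : (0 < Y)%N by rewrite /Y !addn_gt0 B0.
have kap0Y : ((kap0 * Y) ^ kap0 <= #|F|)%N.
  apply: leq_trans kq.
  have [->|k0] := posnP kap0; first by rewrite expn_gt0 muln_gt0 u0 /kappa addn_gt0 orbT.
  apply: (@leq_trans ((kappa * u) ^ (5 * kap0))).
    rewrite [leqRHS]expnM leq_exp2r // expnMn.
    apply: (@leq_trans (kappa * u ^ 5)); last by rewrite leq_mul2r (@leq_pexp2l kappa 1) ?orbT // addn_gt0 orbT.
    by apply: leq_trans (leq_mul (leqnn _) Y5) _; rewrite mulnA leq_mul2r /kappa; apply/orP; right; lia.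
  by rewrite leq_pexp2l // ?muln_gt0 ?u0 /kappa; lia.
have Yq : (Y <= #|F|)%N.
  apply: leq_trans kq; apply: (@leq_trans ((kappa * u) ^ 5)).
    rewrite expnMn; apply: leq_trans Y5 _; rewrite leq_mul2r; apply/orP; right.
    by apply: (@leq_trans kappa); [rewrite /kappa; lia | apply: (@leq_pexp2l kappa 1); rewrite // addn_gt0 orbT].
  by rewrite leq_pexp2l // ?muln_gt0 ?u0 /kappa; lia.
have indB : independent_upto d s g B.
  by apply: (ind F I s g delta K phi beta cardI dsq priv sg B Y) => //; rewrite /Y leq_add2r -addnA leq_addr.
have g0 i : g i != 0 by apply: contra (nonzero_at0 priv i) => /eqP ->; rewrite root0.
have := @stepanov_count F I d s g delta g0 sg B k M zeta d0 dsq indB.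
rewrite cardI -/Gam -/P -/(pattern_set s g zeta).
have -> : (M <= #|F|)%N by exact: leq_trans (leq_trans (leq_addl _ _) (leq_addr Gam _)) Yq.
have -> : (M * (B + k + M * Gam) < P * k * B)%N.
  have H : (kap * (k + P * kap * Gam) < B)%N.
    rewrite /B mulnDr mulnDr muln1 -addSn leq_add //.
      by rewrite -mulnn ltn_mul2r ltnSn.
    rewrite (_ : kap * (P * kap * Gam) = kap ^ 2 * (P * Gam))%N; last by ring.
    by rewrite leq_mul // leq_exp2r // leqW.
  rewrite (_ : M * (B + k + M * Gam) = P * (kap * B + kap * (k + P * kap * Gam)))%N; last by rewrite /M; ring.
  by rewrite -[ltnRHS]mulnA ltn_pmul2l // /k mulSn addnC ltn_add2r.
move=> /(_ isT isT) H.
rewrite -(@leq_pmul2r (Gam + 2)) ?addn_gt0 ?orbT //.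
have H1 : (B + Gam * (#|F| + M) + #|F| * k <= #|F| * (Gam + 2) * lam.+1)%N.
  rewrite (_ : #|F| * (Gam + 2) * lam.+1 = #|F| * Gam + 2 * #|F| + #|F| * kap)%N; last by rewrite /kap; ring.
  rewrite (mulnDr Gam) /k (mulnS #|F|) (mulnC Gam #|F|).
  have aux a b e i j l q : (l + a + i + j <= q -> l + (b + a) + (q + e) <= b + 2 * q + e)%N.
    clear; lia.
  exact: aux Yq.
rewrite (_ : #|F| * lam.+1 * (Gam + 2) = #|F| * (Gam + 2) * lam.+1)%N; last by ring.
apply: leq_trans (leq_trans H H1); apply: eq_leq; rewrite /M /kap; ring.
Qed.

(** * Primes and the totient *)

Section NumberTheory.
Local Open Scope nat_scope.

(** The i-th entry p is at least m + i, so p/(p - 1) <= (m + i)/(m + i - 1), and these bounds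
    telescope. *)
Lemma prod_sorted_leq m (s : seq nat) : path ltn m s ->
  m * \prod_(p <- s) p <= (m + size s) * \prod_(p <- s) p.-1.
Proof.
elim: s m => [|p s IH] m /=; first by rewrite !big_nil addn0.
case/andP=> mp ps; rewrite !big_cons.
have {}IH : m.+1 * \prod_(j <- s) j <= (m + (size s).+1) * \prod_(j <- s) j.-1.
  rewrite addnS -addSn; apply: IH; case: s ps => //= a s /andP[pa ->].
  by rewrite (leq_ltn_trans mp pa).
have mp1 : m * p <= m.+1 * p.-1 by nia.
rewrite mulnA; apply: leq_trans (leq_mul mp1 (leqnn _)) _.
by rewrite -mulnA mulnCA [leqRHS]mulnCA leq_mul2l IH orbT.
Qed.

Lemma leq_totient n : 0 < n -> n <= (size (primes n)).+1 * totient n.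
Proof.
move=> n0; rewrite totientE // {1}[n]prod_prime_decomp // prime_decompE big_map /=.
have -> : \prod_(p <- primes n) p ^ logn p n =
    (\prod_(p <- primes n) p) * \prod_(p <- primes n) p ^ (logn p n).-1.
  rewrite -big_split /=; apply: eq_big_seq => p; rewrite -logn_gt0 => l0.
  by rewrite -expnS prednK.
rewrite big_split /= mulnA leq_mul // -[leqLHS]mul1n -add1n prod_sorted_leq //.
have := sorted_primes n; have : all (leq 2) (primes n).
  by apply/allP => p; rewrite mem_primes => /andP[/prime_gt1].
by case: (primes n) => //= a s /andP[-> _].
Qed.

Lemma size_primes_leq n : 0 < n -> 2 ^ size (primes n) <= n.
Proof.
move=> n0; rewrite {2}[n]prod_prime_decomp // prime_decompE big_map /=.
rewrite -sum1_size expn_sum big_seq [leqRHS]big_seq; apply: leq_prod => p pn.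
rewrite expn1; move: (pn); rewrite mem_primes => /and3P[/prime_gt1 p1 _ _].
by rewrite (leq_trans p1) // -{1}(expn1 p) leq_pexp2l ?(ltnW p1) // logn_gt0.
Qed.

(** In Legendre's formula each term floor(2n/p^k) - 2 floor(n/p^k) is 0 or 1, and it vanishes once
    p^k > 2n. *)
Lemma pfactor_bin_leq p n : prime p -> 0 < n -> p ^ logn p 'C(n.*2, n) <= n.*2.
Proof.
move=> p_pr n0; have p1 := prime_gt1 p_pr; have n2 : 0 < n.*2 by rewrite double_gt0.
suff : logn p 'C(n.*2, n) <= trunc_log p n.*2.
  by move=> H; apply: leq_trans (trunc_logP p1 n2); rewrite leq_pexp2l // ltnW.
set t := trunc_log p n.*2.
have dbl k : (n %/ p ^ k).*2 <= n.*2 %/ p ^ k <= (n %/ p ^ k).*2.+1.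
  have pk : 0 < p ^ k by rewrite expn_gt0 prime_gt0.
  rewrite leq_divRL // -[X in _ && X]ltnS ltn_divLR // -!muln2 mulnAC leq_mul2r leq_trunc_div /=.
  by have := ltn_ceil n pk; lia.
have vanish k m : m < p ^ k -> m %/ p ^ k = 0 by apply: divn_small.
have logn_fact2 : logn p n`! = \sum_(1 <= k < n.*2.+1) n %/ p ^ k.
  rewrite logn_fact // [RHS](big_cat_nat (n := n.+1)) ?ltnS -?addnn ?leq_addl //=.
  rewrite [X in _ = _ + X]big1_seq ?addn0 // => k /andP[_]; rewrite mem_index_iota => /andP[nk _].
  by rewrite vanish // (leq_trans nk) // ltnW // ltn_expl.
have -> : logn p 'C(n.*2, n) =
    \sum_(1 <= k < n.*2.+1) (n.*2 %/ p ^ k - (n %/ p ^ k).*2).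
  rewrite sumnB => [|k _]; last by case/andP: (dbl k).
  have := bin_fact (leq_addl n n); rewrite addnn -{2}addnn addnK => /(congr1 (logn p)).
  rewrite !lognM ?muln_gt0 ?fact_gt0 ?bin_gt0 -?addnn ?leq_addl // addnn.
  rewrite [in RHS]logn_fact // => <-; rewrite addnn logn_fact2.
  under [X in _ - X]eq_bigr do rewrite -muln2.
  by rewrite -big_distrl /= muln2 addnK.
have t2 : t < n.*2.+1.
  rewrite ltnS; apply: leq_trans (trunc_logP p1 n2); apply: ltnW; exact: ltn_expl.
rewrite (big_cat_nat (n := t.+1)) //= [X in _ + X]big1_seq ?addn0.
  apply: (@leq_trans (\sum_(1 <= k < t.+1) 1)).
    apply: leq_sum => k _; rewrite leq_subLR addn1; by case/andP: (dbl k).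
  by rewrite sum_nat_const_nat subn1 muln1.
move=> k /andP[_]; rewrite mem_index_iota => /andP[tk _].
rewrite vanish ?sub0n //; apply: leq_trans (trunc_log_ltn _ p1) _.
by rewrite leq_pexp2l // ltnW.
Qed.

Definition prime_pi y := size [seq p <- iota 0 y.+1 | prime p].

(** The central binomial coefficient is at least 2^n, and each of its prime power factors is at most
    2n. *)
Lemma chebyshev n : 0 < n -> 2 ^ n <= n.*2 ^ prime_pi n.*2.
Proof.
move=> n0; apply: (@leq_trans 'C(n.*2, n)).
  rewrite -addnn -binomial.Vandermonde -[2]/(1 + 1) expnDn; apply: leq_sum => i _.
  by rewrite !exp1n !muln1 leq_pmulr // bin_gt0 leq_subr.
rewrite [leqLHS]prod_prime_decomp ?bin_gt0 -?addnn ?leq_addl // prime_decompE big_map /=.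
rewrite addnn; set s := primes _.
have sub : {subset s <= [seq p <- iota 0 n.*2.+1 | prime p]}.
  move=> p ps; move: (ps); rewrite mem_primes => /and3P[p_pr _ _].
  rewrite mem_filter p_pr mem_iota /= add0n ltnS.
  apply: leq_trans (pfactor_bin_leq p_pr n0).
  by rewrite -{1}(expn1 p) leq_pexp2l ?logn_gt0 // prime_gt0.
have sz : size s <= prime_pi n.*2 by apply: uniq_leq_size sub; exact: primes_uniq.
apply: (@leq_trans (\prod_(p <- s) n.*2)).
  rewrite big_seq [leqRHS]big_seq; apply: leq_prod => p ps; apply: pfactor_bin_leq => //.
  by move: ps; rewrite mem_primes => /andP[].
by rewrite big_const_seq count_predT iter_muln_1 leq_pexp2l // double_gt0.
Qed.

Lemma linear_leq_exp a b : exists l0, forall l, l0 <= l -> a * l + b <= 2 ^ l.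
Proof.
exists (6 * (a + b + 1) + 2) => l ll; set j := l./2.
have jl : l <= 2 * j + 1 by rewrite /j; lia.
have j3 : 3 * (a + b + 1) <= j by rewrite /j; lia.
have Hj : 2 ^ j * 2 ^ j <= 2 ^ l by rewrite -expnD leq_pexp2l // /j; lia.
have H1 : j < 2 ^ j by apply: ltn_expl.
by apply: leq_trans Hj; apply: leq_trans (leq_mul H1 (ltnW H1)); nia.
Qed.

(** L stands for log_2 q. The window y is a power of two of order L^2: it contains more than any
    fixed multiple of L primes, while a fixed power of it stays below 2^L. *)
Lemma prime_window A kappa : exists L0, forall L, L0 <= L ->
  exists y, A * L.+1 <= prime_pi y /\ (kappa * y) ^ kappa <= 2 ^ L.
Proof.
have [l1 H1] := linear_leq_exp (2 * A) (3 * A).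
have [l2 H2] := linear_leq_exp (2 * kappa) (kappa * (kappa + 3)).
exists (2 ^ (l1 + l2)) => L hL.
have L0 : 0 < L by apply: leq_trans hL; rewrite expn_gt0.
set l := trunc_log 2 L.
have lL : 2 ^ l <= L by apply: trunc_logP.
have Ll : L < 2 ^ l.+1 by apply: trunc_log_ltn.
have ll : l1 + l2 <= l by apply: trunc_log_max.
have {}H1 := H1 l (leq_trans (leq_addr _ _) ll).
have {}H2 := H2 l (leq_trans (leq_addl _ _) ll).
exists (2 ^ (2 * l + 3)); split.
  have := @chebyshev (2 ^ (2 * l + 2)) (ltac:(by rewrite expn_gt0)).
  rewrite -mul2n -expnS -addnS -expnM leq_exp2l // => C.
  have k0 : 0 < 2 * l + 3 by rewrite addn_gt0 orbT.
  rewrite -(leq_pmul2l k0); apply: leq_trans C.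
  apply: (@leq_trans ((2 * A * l + 3 * A) * 2 ^ l.+1)).
    rewrite (_ : 2 * A * l + 3 * A = (2 * l + 3) * A); last by ring.
    by rewrite -mulnA leq_mul // leq_mul.
  apply: leq_trans (leq_mul H1 (leqnn _)) _.
  by rewrite -expnD leq_pexp2l //; lia.
apply: (@leq_trans ((2 ^ (kappa + 3 + 2 * l)) ^ kappa)).
  have [->|k0] := posnP kappa; first by rewrite !expn0.
  rewrite leq_exp2r // -addnA (expnD 2 kappa) (addnC 3) leq_mul // ltnW //; exact: ltn_expl.
rewrite -expnM leq_exp2l //; apply: leq_trans lL; apply: leq_trans H2.
by apply: eq_leq; ring.
Qed.
End NumberTheory.

(** * Private roots of shifted powers *)

Lemma mup_simple (K : fieldType) (f : {poly K}) x :
  f != 0 -> root f x -> ~~ root f^`() x -> mup x f = 1%N.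
Proof.
move=> f0 fx f'x; apply/eqP; rewrite eqn_leq mup_leq // -XsubC_dvd // dvdp_XsubCl fx andbT.
apply: contra f'x => /dvdpP[h ->].
by rewrite /root expr2 !derivM !derivXsubC !(hornerXsubC, hornerM, hornerD) subrr !(mulr0, mul0r, addr0).
Qed.

Section PowerShift.
Variables (F : finFieldType) (T : finType) (n D : nat) (c : 'I_n -> F) (u : T -> nat).

Definition power_shift (i : T * 'I_n) : {poly F} := 'X^(D * u i.1) + (c i.2)%:P.

Hypothesis c_inj : injective c.
Hypothesis c0 : forall j, c j != 0.
Hypothesis D0 : (0 < D)%N.
Hypothesis Du_unit : forall t, (D * u t)%:R != 0 :> F.
Hypothesis u_coprime : forall t t', t != t' -> coprime (u t) (u t').
Hypothesis u_large : forall t, (#|T| * n < u t)%N.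

Lemma power_shift_gt0 t : (0 < D * u t)%N.
Proof. by rewrite muln_gt0 D0 (leq_ltn_trans _ (u_large t)). Qed.

Lemma size_power_shift i : size (power_shift i) = (D * u i.1).+1.
Proof.
rewrite size_polyDl size_polyXn // size_polyC.
by rewrite (leq_ltn_trans (leq_b1 _)) // ltnS power_shift_gt0.
Qed.

Section InClosure.
Variables (K : closedFieldType) (phi : {rmorphism F -> K}).

Lemma root_power_shift i x :
  root (map_poly phi (power_shift i)) x = (x ^+ (D * u i.1) == - phi (c i.2)).
Proof.
by rewrite rmorphD /= map_polyXn map_polyC /root hornerD hornerXn hornerC addr_eq0.
Qed.

(** If x is also a root of the k-th polynomial and the two u differ, Bezout's identity for them
    determines x^D as [v k]. So the shared roots number at most |T| n D, fewer than the D u distinct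
    roots available. With equal u the constants differ, and there is no common root. *)
Lemma power_shift_private i : exists x, 
  mup x (map_poly phi (power_shift i)) = 1%N /\
  forall k, k != i -> ~~ root (map_poly phi (power_shift k)) x.
Proof.
set f := map_poly phi (power_shift i).
have f0 : f != 0 by rewrite map_poly_eq0 -size_poly_gt0 size_power_shift.
have simple x : root f x -> mup x f = 1%N.
  move=> fx; apply: mup_simple => //; move: fx.
  rewrite root_power_shift => /eqP fx.
  have x0 : x != 0.
    apply: contraTneq isT => x0; move/eqP: fx; rewrite x0 expr0n eqn0Ngt power_shift_gt0 /=.
    by rewrite eq_sym oppr_eq0 fmorph_eq0 (negPf (c0 _)).
  rewrite /f deriv_map derivD derivC addr0 derivXn rmorphMn /= map_polyXn.
  rewrite /root hornerMn hornerXn -mulr_natr mulf_neq0 ?expf_neq0 //.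
  by rewrite -(rmorph_nat phi) fmorph_eq0.
have [s Es] := closed_field_poly_normal f.
have roots x : (x \in s) = root f x.
  by rewrite Es rootZ ?lead_coef_eq0 // root_prod_XsubC.
have us : uniq s.
  apply: count_mem_uniq => x; case: (boolP (x \in s)) => [xs|/count_memPn //].
  have := simple x; rewrite -roots xs => /(_ isT).
  rewrite {1}Es -mul_polyC mupMr ?rootC ?lead_coef_eq0 //.
  by rewrite mu_prod_XsubC.
have ss : size s = (D * u i.1)%N.
  have := congr1 (fun p : {poly K} => size p) Es.
  by rewrite size_scale ?lead_coef_eq0 // size_prod_XsubC size_map_poly size_power_shift => -[].
pose v (k : T * 'I_n) := (- phi (c i.2)) ^+ (egcdn (u i.1) (u k.1)).1
    / (- phi (c k.2)) ^+ (egcdn (u i.1) (u k.1)).2.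
pose Bad : {poly K} := \prod_(k : T * 'I_n) ('X^D - (v k)%:P).
have sBad : size Bad = (#|T| * n * D).+1.
  rewrite /Bad size_prod => [|k _]; last by rewrite -size_poly_gt0 size_XnsubC.
  under eq_bigr do rewrite size_XnsubC //.
  by rewrite sum_nat_const card_prod card_ord mulnS -addnS addnC addnK.
have Bad0 : Bad != 0 by rewrite -size_poly_gt0 sBad.
have [/(max_poly_roots Bad0)/(_ us)|] := boolP (all (root Bad) s).
  by rewrite ss sBad mulnC ltnS leq_pmul2r // leqNgt u_large.
case/allPn => x xs xBad; exists x; split; first by apply: simple; rewrite -roots.
move=> k ki; apply: contra xBad => kx.
have ix : root f x by rewrite -roots.
move: kx ix; rewrite !root_power_shift => /eqP kx /eqP ix.
have [eqt|net] := eqVneq k.1 i.1.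
  move: ki; rewrite -pair_eqE /= eqt eqxx /= => /negP[]; apply/eqP.
  apply: c_inj; apply: (fmorph_inj phi); apply: oppr_inj; rewrite -ix -kx eqt.
  by [].
rewrite /root horner_prod; apply/prodf_eq0; exists k => //.
rewrite !hornerE subr_eq0; apply/eqP.
have bez : ((egcdn (u i.1) (u k.1)).1 * u i.1 = (egcdn (u i.1) (u k.1)).2 * u k.1 + 1)%N.
  have ui : (0 < u i.1)%N by rewrite (leq_ltn_trans _ (u_large _)).
  have := u_coprime net; rewrite coprime_sym /coprime => /eqP E1.
  by case: egcdnP => // a b; rewrite E1.
apply: (canRL (mulfK _)); first by rewrite expf_neq0 // oppr_eq0 fmorph_eq0.
rewrite -ix -kx -!exprM -exprD; congr (_ ^+ _).
by rewrite -!mulnA (mulnC (u i.1)) bez (mulnC (u k.1)); ring.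
Qed.
End InClosure.

Lemma power_shift_private_roots : exists (K : closedFieldType) (phi : {rmorphism F -> K})
  (beta : T * 'I_n -> K), private_roots power_shift phi beta.
Proof.
have [K [phi _]] := countable_algebraic_closure F.
exists K, phi.
have H i := power_shift_private phi i.
have {H} /fin_all_exists[beta H] := H.
exists beta; split; [|by move=> i; case: (H i)|by move=> i k; case: (H i) => _; apply].
move=> i; rewrite /root hornerD hornerXn hornerC expr0n eqn0Ngt power_shift_gt0 add0r.
exact: c0.
Qed.
End PowerShift.

(** * Generators with prescribed shifts *)

(** Chebyshev's inequality: [X t] is P times the number of good u, minus its expected value V. It
    equals -V on S, while the hypotheses bound the sum of its squares by q V (P + 1)^2. *)
Lemma second_moment (T : finType) (U : seq nat) (good : nat -> T -> bool) (S : {set T}) (P : nat) :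
  uniq U ->
  {in U &, forall u u', u != u' ->
     P ^ 2 * #|[set t | good u t && good u' t]| * size U <= #|T| * (size U).+1}%N ->
  {in U, forall u, #|T| * size U <= P * #|[set t | good u t]| * size U + #|T| * P}%N ->
  {in U, forall u, {in S, forall t, ~~ good u t}} ->
  (size U * #|S| <= #|T| * P.+1 ^ 2)%N.
Proof.
move=> uU H2 H1 H0; set V := size U in H1 H2 *; set q := #|T| in H1 H2 *.
have [V0|V0] := posnP V; first by rewrite V0.
pose a u t : int := (good u t)%:R.
pose X t : int := P%:R * (\sum_(u <- U) a u t) - V%:R.
have lower : (#|S| * V ^ 2)%:R <= \sum_t X t ^+ 2.
  rewrite (bigID (mem S)) /= -[leLHS]addr0 lerD //; last by apply: sumr_ge0 => t _; exact: sqr_ge0.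
  rewrite mulnC natrM mulr_natr -sumr_const ler_sum // => t tS.
  rewrite /X big_seq big1 => [|u uu]; last by rewrite /a (negPf (H0 u uu t tS)).
  by rewrite mulr0 sub0r sqrrN natrX.
have upper : \sum_t X t ^+ 2 = P%:R ^+ 2 * (\sum_(u <- U) \sum_(u' <- U) \sum_t a u t * a u' t)
    - 2 * (P%:R * V%:R) * (\sum_(u <- U) \sum_t a u t) + q%:R * V%:R ^+ 2.
  have -> : \sum_(u <- U) \sum_(u' <- U) \sum_t a u t * a u' t = \sum_t (\sum_(u <- U) a u t) ^+ 2.
    under eq_bigr do rewrite exchange_big /=.
    rewrite exchange_big /=; apply: eq_bigr => t _; rewrite expr2 mulr_suml.
    by apply: eq_bigr => u _; rewrite mulr_sumr.
  rewrite [X in _ - _ * X + _]exchange_big /= !mulr_sumr -sumrB.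
  rewrite (_ : q%:R * V%:R ^+ 2 = \sum_(t : T) V%:R ^+ 2); last by rewrite sumr_const mulr_natl.
  by rewrite -big_split; apply: eq_bigr => t _; rewrite /X /=; ring.
have card1 (b : T -> bool) : \sum_t (b t)%:R = #|[set t | b t]|%:R :> int.
  rewrite -sum1_card natr_sum [RHS]big_mkcond /=; apply: eq_bigr => t _.
  by rewrite inE; case: (b t).
have sumU (x : int) : \sum_(u <- U) x = x *+ V.
  by rewrite big_const_seq count_predT iter_addr_0.
have pairs : V%:R * (P%:R ^+ 2 * (\sum_(u <- U) \sum_(u' <- U) \sum_t a u t * a u' t)) <=
    V%:R ^+ 2 * (P%:R ^+ 2 * q%:R + q%:R * V.+1%:R) :> int.
  have row u : u \in U -> V%:R * (P%:R ^+ 2 * \sum_(u' <- U) \sum_t a u t * a u' t) <=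
      V%:R * (P%:R ^+ 2 * q%:R + q%:R * V.+1%:R) :> int.
    move=> uu; rewrite (bigD1_seq u) //= 2!mulrDr [leRHS]mulrDr lerD //.
      rewrite !ler_wpM2l ?exprn_ge0 ?ler0n //.
      under eq_bigr do rewrite /a -natrM mulnb andbb.
      by rewrite card1 ler_nat max_card.
    rewrite !mulr_sumr.
    apply: (@le_trans _ _ (\sum_(u' <- U) q%:R * V.+1%:R)); last first.
      by rewrite sumU [leRHS]mulr_natl.
    rewrite big_mkcond /= big_seq [leRHS]big_seq ler_sum // => u' uu'.
    case: ifP => [ne|_]; last by rewrite mulr_ge0 ?ler0n.
    under eq_bigr do rewrite /a -natrM mulnb.
    rewrite (card1 (fun t => good u t && good u' t)) -natrX -!natrM ler_nat.
    by rewrite mulnC H2 // eq_sym.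
  rewrite [P%:R ^+ 2 * (\sum_(u <- U) _)]mulr_sumr mulr_sumr.
  rewrite [V%:R ^+ 2]expr2 -[leRHS]mulrA [leRHS]mulr_natl [leRHS](esym (sumU _)).
  by rewrite big_seq [leRHS]big_seq; apply: ler_sum.
have singles : V%:R * (q%:R * (V%:R - P%:R)) <= (P%:R * V%:R) * (\sum_(u <- U) \sum_t a u t) :> int.
  rewrite mulr_sumr [leLHS]mulr_natl [leLHS](esym (sumU _)) big_seq [leRHS]big_seq; apply: ler_sum => u uu.
  rewrite card1 mulrBr lerBlDr -!natrM -natrD ler_nat.
  by rewrite mulnAC H1.
suff : V%:R ^+ 2 * (V * #|S|)%:R <= V%:R ^+ 2 * (q * P.+1 ^ 2)%:R :> int.
  by rewrite ler_pM2l ?exprn_gt0 ?ltr0n // ler_nat.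
have Vge0 : 0 <= V%:R :> int by rewrite ler0n.
have := ler_wpM2l Vge0 lower; rewrite upper => low2.
have sing2 := ler_wpM2l Vge0 singles.
rewrite [leLHS](_ : _ = V%:R * (#|S| * V ^ 2)%:R); last by rewrite !natrM; ring.
apply: le_trans low2 _.
rewrite mulrDr mulrBr.
apply: le_trans (_ : _ <= V%:R ^+ 2 * (P%:R ^+ 2 * q%:R + q%:R * V.+1%:R)
   - 2 * (V%:R * (V%:R * (q%:R * (V%:R - P%:R)))) + V%:R * (q%:R * V%:R ^+ 2)) _.
  rewrite lerD2r lerD // lerN2 mulrCA -mulrA ler_wpM2l // ler_wpM2l //.
by rewrite natrM natrX -!natr1 le_eqVlt; apply/orP; left; apply/eqP; ring.
Qed.

Lemma card_unity_roots (F : finFieldType) n : (0 < n)%N -> (#|[set x : F | (x ^+ n == 1)%R]| <= n)%N.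
Proof.
move=> n0; have p0 : 'X^n - 1%:P != 0 :> {poly F} by rewrite -size_poly_gt0 size_XnsubC.
rewrite cardE -ltnS -(size_XnsubC (1 : F) n0) max_poly_roots ?enum_uniq //.
by apply/allP => x; rewrite mem_enum inE rootE !hornerE => /eqP ->; rewrite subrr.
Qed.

(** Away from the roots, each t realizes one of at most d^|I| patterns of d-th roots of unity; the
    upper bounds for all others leave enough points for the pattern 1. *)
Lemma pattern_lower_bound (F : finFieldType) (I : finType) d s (g : I -> {poly F}) lam :
  (0 < d)%N -> (d * s).+1 = #|F| ->
  (forall zeta, d ^ #|I| * #|pattern_set s g zeta| * lam <= #|F| * lam.+1)%N ->
  (d ^ #|I| * #|[set t | [exists i, root (g i) t]]| * lam <= #|F|)%N ->
  (#|F| * lam <= d ^ #|I| * #|pattern_set s g (fun=> 1%R)| * lam + #|F| * d ^ #|I|)%N.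
Proof.
move=> d0 dsq ub badle; set bad := [set t | _] in badle; set P := (d ^ #|I|)%N in ub badle *.
pose Mu := [set x : F | x ^+ d == 1].
have cMu : (#|Mu| <= d)%N by exact: card_unity_roots.
have cfun : (#|(ffun_on Mu : {pred {ffun I -> F}})| <= P)%N.
  rewrite card_ffun_on /P.
  by have [->|I0] := posnP #|I|; rewrite ?expn0 // leq_exp2r.
pose phi t := [ffun i => (g i).[t] ^+ s] : {ffun I -> F}.
have cover : (#|F| <= #|bad| + \sum_(f | f \in ffun_on Mu) #|pattern_set s g f|)%N.
  rewrite -cardsT -(cardsID bad) setTI leq_add2l -sum1_card.
  rewrite (partition_big phi (fun f => f \in ffun_on Mu)) /=.
    apply: leq_sum => f _; rewrite sum1dep_card; apply/subset_leq_card/subsetP => t.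
    by rewrite !inE => /andP[_ /eqP <-]; apply/forallP => i; rewrite ffunE.
  move=> t; rewrite !inE andbT negb_exists => /forallP gt.
  apply/ffun_onP => i; rewrite ffunE inE -exprM mulnC.
  have := expf_card (g i).[t]; rewrite -dsq exprS => /eqP.
  by rewrite -subr_eq0 -{3}[(g i).[t]]mulr1 -mulrBr mulf_eq0 subr_eq0 -rootE (negPf (gt i)).
pose one : {ffun I -> F} := [ffun=> 1].
have one_in : one \in ffun_on Mu.
  by apply/ffun_onP => i; rewrite ffunE inE expr1n.
have one_pat : pattern_set s g one = pattern_set s g (fun=> 1).
  by apply/setP => t; rewrite !inE; apply: eq_forallb => i; rewrite ffunE.
move: cover; rewrite (bigD1 one) //= one_pat => cover.
have rest : (P * (\sum_(f | (f \in ffun_on Mu) && (f != one)) #|pattern_set s g f|) * lam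
    <= P.-1 * (#|F| * lam.+1))%N.
  rewrite big_distrr big_distrl /=.
  apply: (@leq_trans (\sum_(f : {ffun I -> F} | (f \in ffun_on Mu) && (f != one)) #|F| * lam.+1)%N).
    by apply: leq_sum => f _.
  rewrite sum_nat_const leq_mul2r; apply/orP; right.
  rewrite (cardD1 one) [one \in _]one_in add1n in cfun.
  rewrite -ltnS (leq_trans _ (leqSpred P)) // (leq_trans _ cfun) // ltnS.
  by apply: eq_leq; apply: eq_card => f; rewrite [LHS]inE [RHS]inE andbC.
have P0 : (0 < P)%N by rewrite expn_gt0 d0.
have := leq_mul (leq_mul (leqnn P) cover) (leqnn lam).
move: badle rest; case: (P) P0 => // p _ /=.
set A := #|bad|; set Z := #|pattern_set _ _ _|; set R := (\sum_(_ | _) _)%N.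
rewrite (_ : p.+1 * (A + (Z + R)) * lam = p.+1 * A * lam + (p.+1 * Z * lam + p.+1 * R * lam))%N; last by ring.
rewrite (_ : p.+1 * #|F| * lam = #|F| * lam + p * (#|F| * lam))%N; last by ring.
rewrite (_ : #|F| * p.+1 = #|F| + p * #|F|)%N; last by ring.
rewrite (_ : p * (#|F| * lam.+1) = p * #|F| + p * (#|F| * lam))%N; last by ring.
have aux a z r q ql pql pq : (a <= q -> r <= pq + pql ->
  ql + pql <= a + (z + r) -> ql <= z + (q + pq))%N by clear; lia.
exact: aux.
Qed.

Lemma field_generators (F : finFieldType) : exists S : {set F},
  #|S| = totient #|F|.-1 /\ {in S, forall t k, (t ^+ k == 1) = (#|F|.-1 %| k)%N}.
Proof.
have /cyclicP[a Ea] := field_unit_group_cyclic [set: {unit F}]%G.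
have oa : #[a]%g = #|F|.-1 by rewrite /order -Ea card_finField_unit.
exists [set val x | x : {unit F} in [set x | generator <[a]>%g x]]; split.
  by rewrite card_imset ?totient_gen -?oa ?totient_gen //; apply: val_inj.
move=> _ /imsetP[x + ->] k; rewrite inE => /eqP gx.
rewrite -(FinRing.val_unitX k x) -oa /order gx order_dvdn.
by rewrite -(inj_eq val_inj).
Qed.

(** Not dividing q makes X^(D u) + c separable, not dividing q - 1 keeps t^u a generator, and u > 2n
    leaves room for private roots when one or two values of u are involved. *)
Definition sieve n q y :=
  [seq u <- [seq u <- iota 0 y.+1 | prime u] | ~~ (u %| q * q.-1) && (2 * n < u)]%N.

Lemma mem_sieve n q y u : (u \in sieve n q y) =
  [&& ~~ (u %| q * q.-1), 2 * n < u, prime u & u <= y]%N.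
Proof. by rewrite !mem_filter mem_iota /= add0n ltnS -andbA. Qed.

Lemma uniq_sieve n q y : uniq (sieve n q y).
Proof. by do 2![apply: filter_uniq]; apply: iota_uniq. Qed.

Lemma size_sieve_leq n q y : (size (sieve n q y) <= y)%N.
Proof.
rewrite -[leqRHS](size_iota 1 y); apply: uniq_leq_size (uniq_sieve _ _ _) _ => u.
rewrite mem_sieve mem_iota add1n ltnS => /and4P[_ _ /prime_gt0 -> ->] //.
Qed.

Lemma size_sieve n q y L : (1 < q)%N -> (q < 2 ^ L.+1)%N ->
  (prime_pi y <= size (sieve n q y) + (2 * L.+1 + (2 * n).+1))%N.
Proof.
move=> q1 qL; have qq0 : (0 < q * q.-1)%N by case: q q1 {qL} => [|[]].
rewrite /prime_pi -(count_predC (fun u => ~~ (u %| q * q.-1) && (2 * n < u))%N) /sieve size_filter leq_add2l.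
rewrite -size_filter; apply: (@leq_trans (size (primes (q * q.-1) ++ iota 0 (2 * n).+1))).
  apply: uniq_leq_size; first by do 2![apply: filter_uniq]; apply: iota_uniq.
  move=> u; rewrite !mem_filter mem_cat mem_primes !mem_iota /= add0n !ltnS qq0 /=.
  case/and3P=> + -> _; rewrite /= negb_and negbK -leqNgt => /orP[->|->] //.
  by rewrite orbT.
rewrite size_cat size_iota leq_add2r -ltnS -(@ltn_exp2l 2) //.
apply: leq_ltn_trans (size_primes_leq qq0) _.
apply: (@leq_trans (2 ^ L.+1 * 2 ^ L.+1)).
  by apply: ltn_mul => //; apply: leq_ltn_trans (leq_pred _) qL.
by rewrite -expnD leq_pexp2l //; lia.
Qed.

Lemma card_roots_leq (F : finFieldType) (I : finType) (g : I -> {poly F}) delta :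
  (forall i, g i != 0) -> (forall i, (size (g i) <= delta.+1)%N) ->
  (#|[set t | [exists i, root (g i) t]]| <= #|I| * delta)%N.
Proof.
move=> g0 sg; rewrite cardE -ltnS.
have p0 := prod_exp_neq0 g0 (fun=> 1%N).
apply: leq_trans (max_poly_roots p0 _ (enum_uniq _)) _; last first.
  by rewrite -[X in (_ <= X.+1)%N]mul1n size_prod_exp_leq.
apply/allP => t; rewrite mem_enum inE => /existsP[i /rootP ti].
by rewrite /root horner_prod; apply/prodf_eq0; exists i; rewrite ?horner_exp ?ti.
Qed.

Section KeyLemma.
Variables (F : finFieldType) (d n D s o y : nat) (c : 'I_n -> F).
Local Notation q := #|F|.
Hypothesis D0 : (0 < D)%N.
Hypothesis dsq : (d * s).+1 = q.
Hypothesis Doq : (D * o).+1 = q.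
Hypothesis c_inj : injective c.
Hypothesis c0 : forall j, c j != 0.

Let U := sieve n q y.
Definition shift_good u t := [forall j, (t ^+ (D * u) + c j) ^+ s == 1].

Lemma pattern_set_shift (T : finType) (u : T -> nat) :
  pattern_set s (power_shift D c u) (fun=> 1) = [set t | [forall k, shift_good (u k) t]].
Proof.
apply/setP => t; rewrite !inE; apply/forallP/forallP => H.
  by move=> k; apply/forallP => j; have := H (k, j); rewrite !hornerE.
by case=> k j; have /forallP/(_ j) := H k; rewrite !hornerE.
Qed.

Lemma sieve_unit u : u \in U -> (D * u)%:R != 0 :> F.
Proof.
rewrite mem_sieve => /and4P[uq _ u_pr _]; have [p p_pr pF] := finPcharP F.
rewrite natrM mulf_neq0 //.
  apply/negP => /eqP Dz; have := natr_card0 F.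
  by rewrite -Doq -addn1 natrD natrM Dz mul0r add0r => /eqP; rewrite oner_eq0.
rewrite -(dvdn_pcharf pF) dvdn_prime2 //; apply: contra uq => /eqP <-.
by rewrite dvdn_mulr // (dvdn_pcharf pF) natr_card0.
Qed.

(** [T] will have one element for the first moment and two for the second. *)
Lemma sieve_shift_bound kappa (T : finType) (u : T -> nat) lam :
  (forall (F : finFieldType) (I : finType) s
    (g : I -> {poly F}) delta lam (K : fieldType) (phi : {rmorphism F -> K}) (beta : I -> K),
  #|I| = (#|T| * n)%N -> (d * s).+1 = #|F| -> private_roots g phi beta ->
  (forall i, (size (g i) <= delta.+1)%N) -> (0 < lam)%N ->
  ((kappa * (delta + lam)) ^ kappa <= #|F|)%N ->
  forall zeta, (d ^ (#|T| * n) * #|pattern_set s g zeta| * lam <= #|F| * lam.+1)%N) ->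
  (#|T| <= 2)%N -> (forall k, u k \in U) -> injective u -> (0 < lam)%N ->
  ((kappa * (D * y + lam)) ^ kappa <= q)%N ->
  forall zeta, (d ^ (#|T| * n) * #|pattern_set s (power_shift D c u) zeta| * lam <= q * lam.+1)%N.
Proof.
move=> bound T2 uU u_inj lam0 kq.
have u_unit k : (D * u k)%:R != 0 :> F by apply: sieve_unit.
have u_cop k k' : k != k' -> coprime (u k) (u k').
  have := uU k; have := uU k'; rewrite !mem_sieve => /and4P[_ _ pr' _] /and4P[_ _ pr _] ne.
  by rewrite prime_coprime // dvdn_prime2 // inj_eq.
have u_large k : (#|T| * n < u k)%N.
  have := uU k; rewrite !mem_sieve => /and4P[_ lt _ _].
  by apply: leq_ltn_trans lt; rewrite leq_mul2r T2 orbT.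
have [K [phi [beta priv]]] := power_shift_private_roots c_inj c0 D0 u_unit u_cop u_large.
apply: bound priv _ lam0 kq => //; first by rewrite card_prod card_ord.
move=> i; rewrite (size_power_shift c D0 u_large) ltnS leq_mul2l.
by have := uU i.1; rewrite mem_sieve => /and4P[_ _ _ ->]; rewrite orbT.
Qed.
End KeyLemma.

(** If no generator works, the second moment gives V phi(q - 1) <= q (P + 1)^2. But phi(q - 1) >= (q
    - 1)/(L + 1), and V exceeds 2 (P + 1)^2 (L + 1). *)
Lemma generator_shifts d n D : (0 < d)%N -> (0 < D)%N -> exists q0, forall (F : finFieldType),
  (q0 <= #|F|)%N -> forall s o (c : 'I_n -> F),
  (d * s).+1 = #|F| -> (D * o).+1 = #|F| -> injective c -> (forall j, c j != 0) ->
  exists y : F, (forall k, (y ^+ k == 1) = (o %| k)%N) /\ forall j, (y + c j) ^+ s = 1.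
Proof.
move=> d0 D0; pose P := (d ^ n)%N.
have P0 : (0 < P)%N by rewrite expn_gt0 d0.
have [kappa1 bound1] := stepanov_bound (#|{: unit}| * n) d0.
have [kappa2 bound2] := stepanov_bound (#|{: bool}| * n) d0.
(* Enough primes for more than 2 (P + 1)^2 (L + 1) to remain once the divisors of q (q - 1) and the
   numbers up to 2n are discarded. *)
pose A := (2 * P.+1 ^ 2 + 2 * n + 4)%N.
pose kappa := ((kappa1 + kappa2) * D.+1 + P * n * D + 2)%N.
have [L0 window] := prime_window A kappa.
exists (2 ^ L0.+1)%N => F qlarge s o c dsq Doq c_inj c0; set q := #|F| in qlarge dsq Doq *.
have q2 : (1 < q)%N by exact: finNzRing_gt1.
pose L := trunc_log 2 q.
have Lq : (2 ^ L <= q)%N by rewrite trunc_logP // ltnW.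
have qL : (q < 2 ^ L.+1)%N by exact: trunc_log_ltn.
have L0L : (L0 <= L)%N.
  by apply: trunc_log_max => //; apply: leq_trans qlarge; rewrite leq_pexp2l.
have [y [Ay yL]] := window L L0L.
have kyq : ((kappa * y) ^ kappa <= q)%N := leq_trans yL Lq.
pose U := sieve n q y; pose V := size U.
have Vy : (V <= y)%N by exact: size_sieve_leq.
pose X := (P.+1 ^ 2 * L.+1)%N.
have VX : (2 * X < V)%N.
  have := leq_trans Ay (size_sieve n y q2 qL); rewrite -/U -/V.
  rewrite (_ : A * L.+1 = 2 * X + (2 * n + 4) * L.+1)%N; last by rewrite /A /X; ring.
  have : ((2 * n).+2 <= (2 * n + 2) * L.+1)%N by rewrite -addn2 leq_pmulr.
  rewrite (_ : (2 * n + 4) * L.+1 = (2 * n + 2) * L.+1 + 2 * L.+1)%N; last by ring.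
  have aux a b e x v : (e.+2 <= a -> x + (a + b) <= v + (b + e.+1) -> x < v)%N by clear; lia.
  exact: aux.
have V0 : (0 < V)%N by apply: leq_ltn_trans VX.
have y0 : (0 < y)%N by apply: leq_trans Vy.
have kapbound k : (k <= kappa1 + kappa2)%N -> ((k * (D * y + V)) ^ k <= q)%N.
  move=> kk; apply: leq_trans kyq.
  have [->|k0] := posnP k; first by rewrite expn_gt0 muln_gt0 y0 /kappa addn_gt0 orbT.
  have H : (k * (D * y + V) <= kappa * y)%N.
    apply: (@leq_trans (k * (D.+1 * y))); first by rewrite leq_mul2l mulSn addnC leq_add2r Vy orbT.
    by rewrite mulnA leq_mul2r /kappa -addnA (leq_trans _ (leq_addr _ _)) ?orbT // leq_mul2r kk orbT.
  apply: leq_trans (_ : (kappa * y) ^ k <= _)%N; first by rewrite leq_exp2r.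
  rewrite leq_pexp2l // ?muln_gt0 ?y0 /kappa ?addn_gt0 ?orbT //.
  rewrite -addnA (leq_trans kk) // (leq_trans _ (leq_addr _ _)) // leq_pmulr //.
have [S [cardS genS]] := field_generators F.
(* For a generator t and u prime to q - 1, t^(D u) has order exactly o, so one good pair suffices.
   Otherwise S avoids every good set. *)
have [/existsP[t /andP[tS /hasP[u uU good]]]|none] :=
    boolP [exists t, (t \in S) && has (fun u => shift_good D s c u t) U].
  exists (t ^+ (D * u)); split; last by move=> j; apply/eqP; move/forallP: good.
  move=> k; rewrite -exprM genS //; have qE : (#|F|.-1 = D * o)%N by rewrite -[#|F|]Doq.
  rewrite qE -mulnA dvdn_pmul2l // Gauss_dvdr // coprime_sym.
  move: uU; rewrite mem_sieve => /and4P[uq _ u_pr _].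
  rewrite prime_coprime //; apply: contra uq => uo.
  by rewrite dvdn_mull // -/q -Doq /= dvdn_mull.
have good1 u : u \in U -> forall zeta,
    (P * #|pattern_set s (power_shift D c (fun _ : unit => u)) zeta| * V <= q * V.+1)%N.
  move=> uU; have u_inj : injective (fun _ : unit => u) by move=> [] [].
  have := sieve_shift_bound D0 dsq Doq c_inj c0 bound1 _ (fun=> uU) u_inj V0.
  by rewrite card_unit mul1n; apply => //; apply: kapbound; apply: leq_addr.
have moment : (V * #|S| <= q * P.+1 ^ 2)%N.
  apply: (@second_moment F U (shift_good D s c) S P (uniq_sieve _ _ _)).
  - move=> u u' uU u'U ne; pose w b := if b then u else u'.
    have w_inj : injective w.
      by move=> [] [] //= E; move: ne; rewrite E ?eqxx // -E eqxx.
    have wU b : w b \in U by case: b.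
    have := sieve_shift_bound D0 dsq Doq c_inj c0 bound2 _ wU w_inj V0.
    rewrite card_bool => /(_ isT (kapbound _ (leq_addl _ _)) (fun=> 1)).
    rewrite (_ : d ^ (2 * n) = P ^ 2)%N; last by rewrite mulnC expnM.
    rewrite pattern_set_shift.
    have -> : [set t | [forall k, shift_good D s c (w k) t]] =
        [set t | shift_good D s c u t && shift_good D s c u' t].
      apply/setP => t; rewrite !inE; apply/forallP/andP => [H|[H1 H2]]; last by case.
      by split; [apply: (H true) | apply: (H false)].
    by [].
  - move=> u uU; have := pattern_lower_bound d0 dsq.
    move=> /(_ (unit * 'I_n)%type (power_shift D c (fun _ : unit => u)) V).
    rewrite card_prod card_unit card_ord mul1n -/P => /(_ (good1 u uU)).
    rewrite pattern_set_shift.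
    have -> : [set t | [forall k : unit, shift_good D s c u t]] = [set t | shift_good D s c u t].
      by apply/setP => t; rewrite !inE; apply/forallP/idP => [/(_ tt)|].
    apply; apply: leq_trans kyq.
    have size_u i : size (power_shift D c (fun _ : unit => u) i) = (D * u).+1.
      rewrite size_polyDl size_polyXn // size_polyC (leq_ltn_trans (leq_b1 _)) // ltnS muln_gt0 D0.
      by move: uU; rewrite mem_sieve => /and4P[_ _ /prime_gt0].
    have uy : (u <= y)%N by move: uU; rewrite mem_sieve => /and4P[].
    have roots_leq : (#|[set t | [exists i, root (power_shift D c (fun _ : unit => u) i) t]]| <= n * (D * y))%N.
      have := @card_roots_leq F _ (power_shift D c (fun _ : unit => u)) (D * y).
      rewrite card_prod card_unit card_ord mul1n; apply=> i; first by rewrite -size_poly_gt0 size_u.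
      by rewrite size_u ltnS leq_mul2l uy orbT.
    apply: (@leq_trans ((kappa * y) ^ 2)); last first.
      by rewrite leq_pexp2l ?muln_gt0 ?y0 /kappa ?addn_gt0 ?orbT // leq_addl.
    apply: (@leq_trans (P * (n * (D * y)) * y)); first by rewrite !leq_mul.
    rewrite -mulnn (_ : P * (n * (D * y)) * y = P * n * D * y * y)%N; last by ring.
    rewrite leq_mul //; last by rewrite leq_pmull // addn_gt0 orbT.
    by rewrite leq_mul2r /kappa addnAC leq_addl orbT.
  - move=> u uU t tS; apply: contra none => good; apply/existsP; exists t.
    by rewrite tS; apply/hasP; exists u.
have q1 : (0 < q.-1)%N by rewrite -ltnS prednK // ltnW.
have tot := leq_totient q1; rewrite -cardS in tot.
have omega : (size (primes q.-1) <= L)%N.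
  rewrite -ltnS -(@ltn_exp2l 2) //; apply: leq_ltn_trans qL.
  exact: leq_trans (size_primes_leq q1) (leq_pred q).
exfalso.
have H : (V * q.-1 <= L.+1 * (q * P.+1 ^ 2))%N.
  apply: (@leq_trans (V * (L.+1 * #|S|))).
    by rewrite leq_mul // (leq_trans tot) // leq_mul2r ltnS omega orbT.
  by rewrite mulnCA leq_mul2l moment orbT.
move: H; rewrite (_ : L.+1 * (q * P.+1 ^ 2) = X * q)%N; last by rewrite /X; ring.
apply/negP; rewrite -ltnNge.
apply: (@leq_trans ((2 * X).+1 * q.-1)); last by rewrite leq_mul.
have aux x k : (1 < k)%N -> (x * k < (2 * x).+1 * k.-1)%N.
  by clear; case: k => [|[|k]] //= _; nia.
exact: aux.
Qed.

(** * Cycle types *)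

(** Repeated shifts are merged and zero shifts dropped: for the latter the claim is y^s = 1, which
    follows from o | s. Finitely many pairs of a number of shifts and a D remain, and the largest
    threshold is taken. *)
Lemma generator_shifts_uniform d n Dmax : (0 < d)%N -> exists q0, forall (F : finFieldType),
  (q0 <= #|F|)%N -> forall s o D (c : 'I_n -> F),
  (d * s).+1 = #|F| -> (D * o).+1 = #|F| -> (o %| s)%N -> (D <= Dmax)%N ->
  exists y : F, (forall k, (y ^+ k == 1) = (o %| k)%N) /\ forall j, (y + c j) ^+ s = 1.
Proof.
move=> d0.
have /fin_all_exists[q0 key] (i : 'I_n.+1 * 'I_Dmax.+1) : exists q0, (0 < i.2)%N ->
    forall (F : finFieldType), (q0 <= #|F|)%N -> forall s o (c : 'I_i.1 -> F),
    (d * s).+1 = #|F| -> (i.2 * o).+1 = #|F| -> injective c -> (forall j, c j != 0) ->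
    exists y : F, (forall k, (y ^+ k == 1) = (o %| k)%N) /\ forall j, (y + c j) ^+ s = 1.
  have [i0|i0] := posnP i.2; first by exists 0%N; rewrite i0.
  by have [q0 H] := generator_shifts i.1 d0 i0; exists q0 => _.
exists (\max_i q0 i) => F qF s o D c dsq Doq os DD.
have D0 : (0 < D)%N.
  by case: D Doq {DD} => // -[Fe]; have := finNzRing_gt1 F; rewrite -Fe.
pose cs := undup [seq c j | j <- enum 'I_n & c j != 0].
have sn : (size cs <= n)%N.
  by rewrite (leq_trans (size_undup _)) // size_map size_filter (leq_trans (count_size _ _)) // size_enum_ord.
pose i : 'I_n.+1 * 'I_Dmax.+1 := (Ordinal (sn : (size cs < n.+1)%N), Ordinal (DD : (D < Dmax.+1)%N)).
have qi : (q0 i <= #|F|)%N by apply: leq_trans qF; exact: leq_bigmax.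
have [] := key i D0 F qi s o (fun j : 'I_(size cs) => cs`_j) dsq Doq.
- move=> j k /eqP; rewrite nth_uniq ?undup_uniq // => /eqP; exact: val_inj.
- move=> j; have : cs`_j \in cs by rewrite mem_nth.
  by rewrite mem_undup => /mapP[k]; rewrite mem_filter => /andP[+ _] ->.
move=> y [yo yc]; exists y; split=> // j.
have [->|cj] := eqVneq (c j) 0; first by rewrite addr0; apply/eqP; rewrite yo.
have jc : c j \in cs by rewrite mem_undup map_f // mem_filter cj mem_enum.
by have := yc (Ordinal (etrans (index_mem _ _) jc)); rewrite /= nth_index.
Qed.

Section CycleType.
Variable T : finType.
Implicit Types (s r : {perm T}).

Lemma perm_fixed_dvdn s x k : ((s ^+ k)%g x == x) = (#|porbit s x| %| k)%N.
Proof.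
set l := #|porbit s x|; have l0 : (0 < l)%N by rewrite lt0n card_porbit_neq0.
have E m : (s ^+ (m * l + k %% l))%g x = (s ^+ (k %% l))%g x.
  rewrite expgD permM; congr (fun_of_perm _ _); rewrite permX.
  by elim: m => //= m IH; rewrite mulSn iterD IH iter_porbit.
rewrite {1}(divn_eq k l) E permX /dvdn.
have H i : (i < l)%N -> nth x (traject s x l) i = iter i s x by move=> il; rewrite nth_traject.
have rl : (k %% l < l)%N by rewrite ltn_mod.
by rewrite -H // -{3}[x]/(iter 0 s x) -(H 0%N l0) nth_uniq ?size_traject // uniq_traject_porbit.
Qed.

Lemma card_porbit_eq s r x :
  (forall k, ((s ^+ k)%g x == x) = ((r ^+ k)%g x == x)) -> #|porbit s x| = #|porbit r x|.
Proof.
move=> H; apply/eqP; rewrite eqn_dvd -!perm_fixed_dvdn.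
by rewrite H perm_fixed_dvdn dvdnn -H perm_fixed_dvdn dvdnn.
Qed.

(** The l-cycles partition the points lying on them; cycle types can thus be compared point by
    point. *)
Lemma cycle_type_card s l : (cycle_type s l * l = #|[set x | #|porbit s x| == l]|)%N.
Proof.
rewrite /cycle_type; set Q := [set X in _ | _].
have QP X : reflect (exists2 x, X = porbit s x & #|porbit s x| = l) (X \in Q).
  rewrite inE; apply: (iffP andP) => [[/imsetP[x _ ->] /eqP]|[x -> ->]]; first by exists x.
  by rewrite eqxx imset_f.
have uQ : {in Q, forall X : {set T}, #|X| = l} by move=> X /QP[x -> ->].
rewrite -(card_uniform_partition (D := [set x | #|porbit s x| == l]) uQ) //.
apply/and3P; split.
- apply/eqP/setP => x; rewrite inE; apply/bigcupP/eqP => [[X /QP[y -> yl]]|xl].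
    by rewrite -eq_porbit_mem => /eqP ->.
  by exists (porbit s x); [apply/QP; exists x | exact: porbit_id].
- apply/trivIsetP => _ _ /QP[x -> _] /QP[y -> _].
  apply: contraR; rewrite -setI_eq0 => /set0Pn[z]; rewrite inE -!eq_porbit_mem.
  by move=> /andP[/eqP <- /eqP <-].
- by apply/QP => -[x /esym/setP/(_ x)]; rewrite porbit_id inE.
Qed.

Lemma cycle_type_eq s r : (forall x, #|porbit s x| = #|porbit r x|) -> cycle_type s =1 cycle_type r.
Proof.
move=> H l; have [->|l0] := posnP l.
  have E0 (p : {perm T}) : cycle_type p 0 = 0%N.
    apply/eqP; rewrite cards_eq0; apply/eqP/setP => X; rewrite !inE.
    apply/andP => -[/imsetP[x _ ->]]; exact/negP/card_porbit_neq0.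
  by rewrite !E0.
apply/eqP; rewrite -(eqn_pmul2r l0) !cycle_type_card; apply/eqP/eq_card => x.
by rewrite !inE H.
Qed.
End CycleType.

(** * Cyclotomic mappings *)

Lemma unit_of_neq0 (F : finFieldType) (x : F) : x != 0 -> exists u : {unit F}, val u = x.
Proof. by rewrite -unitfE => Ux; exists (FinRing.unit F Ux). Qed.

(* A coset of the index d subgroup is determined by the common s-th power of its elements. *)
Lemma cyclotomic_mappingP (F : finFieldType) d (f : F -> F) : cyclotomic_mapping d f ->
  exists s, [/\ (d * s).+1 = #|F|, exists alpha : F -> F, forall x, f x = alpha (x ^+ s) * x
    & forall h beta : F -> F, (forall x, h x = beta (x ^+ s) * x) -> cyclotomic_mapping d h].
Proof.
case=> f0 [C [Cd fC]]; pose s := #|C|; have s0 : (0 < s)%N := cardG_gt0 C.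
(* A field has at most s roots of unity of order dividing s, so [C], which has s elements, consists
   of all of them. *)
have memC u : (u \in C) = (val u ^+ s == 1).
  have CS : C \subset [set u : {unit F} | val u ^+ s == 1].
    apply/subsetP => v mup_mapC; rewrite inE -FinRing.val_unitX expg_cardG //.
  suff : C == [set u : {unit F} | val u ^+ s == 1] :> {set {unit F}}.
    by move=> /eqP {1}->; rewrite inE.
  rewrite eqEcard CS /= -(card_imset _ val_inj) (leq_trans _ (card_unity_roots F s0)) //.
  by apply/subset_leq_card/subsetP => _ /imsetP[v + ->]; rewrite !inE.
have same_coset (u v : {unit F}) : (v \in (u *: C)%g) = (val u ^+ s == val v ^+ s).
  rewrite mem_lcoset memC FinRing.val_unitM FinRing.val_unitV exprMn exprVn.
  have us : val u ^+ s != 0 by rewrite expf_neq0 // -unitfE (valP u).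
  by rewrite -(inj_eq (mulfI us)) mulrA mulfV // mul1r mulr1 eq_sym.
have coset_in (u : {unit F}) : (u *: C)%g \in lcosets C [set: {unit F}] by apply/lcosetsP; exists u.
exists s; split.
- rewrite mulnC -Cd Lagrange ?subsetT // card_finField_unit prednK //.
  exact: ltnW (finNzRing_gt1 F).
(* The coefficient is read off at any element whose s-th power is z; the value 0 is taken only where
   there is none. *)
- exists (fun z => if [pick u : {unit F} | val u ^+ s == z] is Some u then f (val u) / val u else 0).
  move=> x; have [->|/unit_of_neq0[v <-]] := eqVneq x 0; first by rewrite f0 mulr0.
  case: pickP => [u /eqP uv|/(_ v)]; last by rewrite eqxx.
  have [a fa] := fC _ (coset_in u).
  rewrite !fa ?same_coset ?uv // mulfK // -unitfE; exact: (valP u).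
- move=> h beta hb; split; first by rewrite hb mulr0.
  exists C; split=> // K /imsetP[u _ ->]; exists (beta (val u ^+ s)) => v.
  by rewrite lcosetE same_coset => /eqP uv; rewrite hb uv.
Qed.

(** * The permutation of the cosets and the iterates along its cycles *)

Section CosetMaps.
Variables (F : finFieldType) (d s n : nat) (alpha : F -> F) (c : 'I_n -> F) (g : {perm F}).
Hypothesis d0 : (0 < d)%N.
Hypothesis dsq : (d * s).+1 = #|F|.
Hypothesis gE : forall x, g x = alpha (x ^+ s) * x.

Definition coset_reps := [set x ^+ s | x in [set~ (0 : F)]].
Local Notation M := coset_reps.

Lemma coset_power x : x != 0 -> x ^+ s \in M.
Proof. by move=> x0; apply/imsetP; exists x; rewrite ?inE. Qed.

Lemma coset_repsP z : reflect (exists2 x, x != 0 & z = x ^+ s) (z \in M).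
Proof.
apply: (iffP imsetP) => [[x]|[x x0 ->]]; first by rewrite !inE; exists x.
by exists x; rewrite ?inE.
Qed.

Lemma card_coset_reps : (#|M| <= d)%N.
Proof.
apply: leq_trans (card_unity_roots F d0); apply/subset_leq_card/subsetP => z.
case/coset_repsP => x x0 ->; rewrite inE -exprM mulnC.
by rewrite -(inj_eq (mulfI x0)) mulr1 -exprS dsq expf_card.
Qed.

Lemma coset_order_gt0 : (0 < s)%N.
Proof. by have := finNzRing_gt1 F; rewrite -dsq; case: s => //; rewrite muln0. Qed.

Lemma coset_map0 : g 0 = 0.
Proof. by rewrite gE mulr0. Qed.

Lemma coset_map_neq0 x : x != 0 -> g x != 0.
Proof. by apply: contra => /eqP gx; apply/eqP/(@perm_inj _ g); rewrite gx coset_map0. Qed.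

Lemma coset_coef_neq0 z : z \in M -> alpha z != 0.
Proof.
case/coset_repsP => x x0 ->; have := coset_map_neq0 x0; rewrite gE.
by apply: contra => /eqP ->; rewrite mul0r.
Qed.

(** The action of [g] on cosets, written on s-th powers; the identity outside [M] extends it to all
    of F. *)
Definition coset_act z := if z \in M then alpha z ^+ s * z else z.

Lemma coset_actE x : x != 0 -> coset_act (x ^+ s) = g x ^+ s.
Proof. by move=> x0; rewrite /coset_act coset_power // gE exprMn. Qed.

Lemma coset_act_M z : (coset_act z \in M) = (z \in M).
Proof.
rewrite {1}/coset_act; case: ifP => // zM; case/coset_repsP: (zM) => x x0 Ez.
have := coset_actE x0; rewrite /coset_act -Ez zM => ->.
exact/coset_power/coset_map_neq0.
Qed.

Lemma coset_act_inj : injective coset_act.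
Proof.
have onto : M \subset coset_act @: M.
  apply/subsetP => _ /coset_repsP[x x0 ->]; have gx : g (g^-1%g x) = x by rewrite permKV.
  have y0 : g^-1%g x != 0 by apply: contraNneq x0 => E; rewrite -gx E coset_map0.
  by apply/imsetP; exists ((g^-1%g x) ^+ s); rewrite ?coset_power // coset_actE // gx.
have injM : {in M &, injective coset_act}.
  by apply/imset_injP; rewrite eqn_leq leq_imset_card subset_leq_card.
move=> z w E; have := congr1 (fun t => t \in M) E; rewrite !coset_act_M.
case: (boolP (z \in M)) => zM; case: (boolP (w \in M)) => wM // _; first exact: injM.
by move: E; rewrite /coset_act (negPf zM) (negPf wM).
Qed.

Definition coset_perm := perm coset_act_inj.

(** Equal s-th powers of the coefficients induce the same permutation of the cosets, and within a
    coset the map is multiplication by a nonzero constant. This serves for f and for each f + c_j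
    id. *)
Lemma coset_map_inj gamma : {in M, forall z, gamma z ^+ s = alpha z ^+ s} ->
  injective (fun x => gamma (x ^+ s) * x).
Proof.
move=> ga; have gam0 x : x != 0 -> gamma (x ^+ s) != 0.
  move=> x0; have := expf_neq0 s (coset_coef_neq0 (coset_power x0)).
  by rewrite -ga ?coset_power // expf_eq0 coset_order_gt0.
have act x : x != 0 -> (gamma (x ^+ s) * x) ^+ s = coset_act (x ^+ s).
  by move=> x0; rewrite exprMn ga ?coset_power // /coset_act coset_power.
move=> x y; have [->|x0] := eqVneq x 0; have [-> //|y0] := eqVneq y 0; rewrite ?mulr0.
- by move/esym/eqP; rewrite mulf_eq0 (negPf (gam0 _ y0)) (negPf y0).
- by move/eqP; rewrite mulf_eq0 (negPf (gam0 _ x0)) (negPf x0).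
move=> E; have Es : x ^+ s = y ^+ s by apply: coset_act_inj; rewrite -!act // E.
by move: E; rewrite Es => /mulfI; apply; rewrite gam0.
Qed.

(* On the union of the cosets in a cycle of length l, the l-th iterate is multiplication by the
   product of the coefficients along the cycle. *)
Lemma coset_map_fixed (f : {perm F}) gamma x k :
  (forall x, f x = gamma (x ^+ s) * x) -> {in M, forall z, gamma z ^+ s = alpha z ^+ s} -> x != 0 ->
  ((f ^+ k)%g x == x) = (#|porbit coset_perm (x ^+ s)| %| k)%N &&
    ((\prod_(z in porbit coset_perm (x ^+ s)) gamma z) ^+ (k %/ #|porbit coset_perm (x ^+ s)|)%N == 1).
Proof.
move=> fE ga x0; set z := x ^+ s; set l := #|_|.
have zM : z \in M by exact: coset_power.
have iterM i : iter i coset_perm z \in M by elim: i => //= i IH; rewrite permE coset_act_M.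
have gam0 i : gamma (iter i coset_perm z) != 0.
  have := expf_neq0 s (coset_coef_neq0 (iterM i)).
  by rewrite -ga // expf_eq0 coset_order_gt0.
have fk i : (f ^+ i)%g x = (\prod_(j < i) gamma (iter j coset_perm z)) * x /\
    ((f ^+ i)%g x) ^+ s = iter i coset_perm z.
  elim: i => [|i [IH1 IH2]]; first by rewrite perm1 big_ord0 mul1r.
  rewrite expgSr permM fE IH2 big_ord_recr /= mulrAC -IH1 mulrC; split => //.
  by rewrite exprMn ga // IH2 mulrC permE /coset_act iterM.
have prodl : \prod_(j < l) gamma (iter j coset_perm z) = \prod_(w in porbit coset_perm z) gamma w.
  have := uniq_traject_porbit coset_perm z; rewrite -/l => ut.
  rewrite (eq_bigl _ _ (porbit_traject coset_perm z)) -/l -(big_uniq _ ut) /=.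
  by rewrite (big_nth z) size_traject big_mkord; apply: eq_bigr => j _; rewrite nth_traject.
have periodic m j : iter (m * l + j) coset_perm z = iter j coset_perm z.
  rewrite addnC iterD; congr (iter _ _ _).
  by elim: m => //= m IH; rewrite mulSn iterD IH iter_porbit.
have [lk|lk] /= := boolP (l %| k)%N; last first.
  apply: contraNF lk => /eqP fx; rewrite -perm_fixed_dvdn permX.
  by have [_ <-] := fk k; rewrite fx.
have prodm m : \prod_(j < m * l) gamma (iter j coset_perm z) =
    (\prod_(w in porbit coset_perm z) gamma w) ^+ m.
  elim: m => [|m IH]; first by rewrite mul0n big_ord0.
  rewrite mulSnr big_split_ord /= IH exprSr -prodl; congr (_ * _).
  by apply: eq_bigr => j _; rewrite periodic.
have [-> _] := fk k; rewrite -[X in _ == X]mul1r (inj_eq (mulIf x0)).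
by have := prodm (k %/ l)%N; rewrite divnK // => ->.
Qed.

End CosetMaps.

(** * Replacing the coefficients while keeping the cycle type *)

Section Replacement.
Variables (F : finFieldType) (d s n Dmax : nat) (alpha : F -> F) (c : 'I_n -> F) (g : {perm F}).
Hypothesis d0 : (0 < d)%N.
Hypothesis dsq : (d * s).+1 = #|F|.
Hypothesis gE : forall x, g x = alpha (x ^+ s) * x.
Hypothesis key : forall o D (c' : 'I_n -> F), (D * o).+1 = #|F| -> (o %| s)%N -> (D <= Dmax)%N ->
  exists y : F, (forall k, (y ^+ k == 1) = (o %| k)%N) /\ forall j, (y + c' j) ^+ s = 1.
Hypothesis dDmax : (d <= Dmax)%N.
Hypothesis long : forall x o D, x != 0 -> (#|porbit g x| <= d * o)%N ->
  (D * o).+1 = #|F| -> (D <= Dmax)%N.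

Local Notation M := (coset_reps F s).
Local Notation pi := (coset_perm gE).
Local Notation A z := (\prod_(w in porbit pi z) alpha w).

Let s0 : (0 < s)%N := coset_order_gt0 dsq.
Let alpha0 z : z \in M -> alpha z != 0 := @coset_coef_neq0 F s alpha g gE z.

Lemma porbit_coset_reps z w : z \in M -> w \in porbit pi z -> w \in M.
Proof.
move=> zM /porbitP[i ->]; rewrite permX; elim: i => //= i IH.
by rewrite permE (coset_act_M gE).
Qed.

Lemma coset_reps_neq0 z : z \in M -> z != 0.
Proof. by case/coset_repsP => x x0 ->; rewrite expf_neq0. Qed.

Lemma cycle_coef_neq0 z : z \in M -> A z != 0.
Proof. by move=> zM; apply/prodf_neq0 => w /(porbit_coset_reps zM)/alpha0. Qed.

(** alpha(w)^s w is the successor of w under [pi], so A(z)^s leaves the product of the cycle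
    unchanged. *)
Lemma cycle_coef_expr z : z \in M -> A z ^+ s = 1.
Proof.
move=> zM; have P0 : \prod_(w in porbit pi z) w != 0.
  by apply/prodf_neq0 => w /(porbit_coset_reps zM)/coset_reps_neq0.
apply: (mulIf P0); rewrite mul1r -prodrXl -big_split /=.
rewrite [RHS](reindex_inj (@perm_inj _ pi)) /=.
apply: eq_big => [w|w wz]; last by rewrite permE /coset_act (porbit_coset_reps zM wz).
by rewrite -!eq_porbit_mem -[pi w]/((pi ^+ 1)%g w) porbit_perm.
Qed.

(** If A(z) has order o and the coset cycle has length l <= d, the (l o)-th iterate of [g] fixes x.
    So the cycle of x has length at most d o, and [long] bounds D. *)
Lemma cycle_coef_order z : z \in M -> exists o D,
  [/\ forall k, (A z ^+ k == 1) = (o %| k)%N, (o %| s)%N, (D * o).+1 = #|F| & (D <= Dmax)%N].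
Proof.
move=> zM; have [u uA] := unit_of_neq0 (cycle_coef_neq0 zM).
pose o := #[u]%g.
have oP k : (A z ^+ k == 1) = (o %| k)%N.
  by rewrite order_dvdn -(inj_eq val_inj) FinRing.val_unitX uA.
have os : (o %| s)%N by rewrite -oP cycle_coef_expr.
have Do : ((#|F|.-1 %/ o) * o).+1 = #|F| by rewrite -dsq /= divnK // dvdn_mull.
exists o, (#|F|.-1 %/ o)%N; split=> //.
case/coset_repsP: (zM) => x x0 zx; apply: (long x0 _ Do).
apply: (@leq_trans (#|porbit pi z| * o)).
  apply: dvdn_leq; first by rewrite muln_gt0 order_gt0 lt0n card_porbit_neq0.
  rewrite -perm_fixed_dvdn (coset_map_fixed dsq gE _ gE) //.
  rewrite -zx dvdn_mulr // mulKn ?lt0n ?card_porbit_neq0 //.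
  by rewrite oP dvdnn.
rewrite leq_mul2r; apply/orP; right; apply: leq_trans (card_coset_reps d0 dsq).
by apply/subset_leq_card/subsetP => w; exact: porbit_coset_reps.
Qed.

(** Multiplication by b and by each b + c_j sends the coset z to the same coset as [g] does. *)
Definition admissible z b := b ^+ s = alpha z ^+ s /\ forall j, (b + c j) ^+ s = alpha z ^+ s.

Lemma admissible_neq0 z b : z \in M -> admissible z b -> b != 0.
Proof.
move=> zM [bs _]; have := expf_neq0 s (alpha0 zM).
by rewrite -bs expf_eq0 s0.
Qed.

Lemma admissible_exists z : exists b, z \in M -> admissible z b.
Proof.
have [zM|] := boolP (z \in M); last by exists 0.
(* Here o = s and D = d; the shifts are rescaled so that b = alpha(z) y. *)
have [y [yo yc]] := key (fun j => c j / alpha z) dsq (dvdnn s) dDmax.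
exists (alpha z * y) => _; split; first by rewrite exprMn (eqP (_ : y ^+ s == 1)) ?mulr1 // yo.
move=> j; rewrite -[c j](divfK (alpha0 zM)) [_ / _ * _]mulrC -mulrDr exprMn yc mulr1 //.
Qed.

(* Only the coefficient at the last coset of a cycle is constrained by the order of the product. *)
Lemma admissible_last (beta : F -> F) z : (forall w, w \in M -> admissible w (beta w)) ->
  exists b, z \in M -> admissible z b /\
    forall k, ((b * \prod_(w in porbit pi z | w != z) beta w) ^+ k == 1) = (A z ^+ k == 1).
Proof.
move=> good; have [zM|] := boolP (z \in M); last by exists 0.
set P := \prod_(_ in _ | _) _.
have P0 : P != 0.
  by apply/prodf_neq0 => w /andP[/(porbit_coset_reps zM) wM _]; apply: admissible_neq0 (good w wM).
have PA : alpha z ^+ s * P ^+ s = 1.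
  rewrite -(cycle_coef_expr zM) (bigD1 z) ?porbit_id //= exprMn; congr (_ * _).
  rewrite /P -!prodrXl; apply: eq_bigr => w /andP[/(porbit_coset_reps zM) wM _].
  by case: (good w wM).
have Ps : alpha z ^+ s = (P ^+ s)^-1 by rewrite -[LHS](mulfK (expf_neq0 s P0)) PA mul1r.
have [o [D [oP os Do DD]]] := cycle_coef_order zM.
(* For b = y / P one has b + c_j = (y + c_j P) / P, and P^(-s) = alpha(z)^s. *)
have [y [yo yc]] := key (fun j => c j * P) Do os DD.
exists (y / P) => _; split; last by move=> k; rewrite divfK // oP yo.
split; first by rewrite exprMn exprVn (eqP (_ : y ^+ s == 1)) ?mul1r // yo.
by move=> j; rewrite -[c j](mulfK P0) -mulrDl exprMn exprVn yc mul1r.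
Qed.

Lemma replacement : exists f : {perm F},
  [/\ exists gamma, forall x, f x = gamma (x ^+ s) * x,
      cycle_type f =1 cycle_type g
    & forall j, bijective (fun x => f x + c j * x)].
Proof.
have /fin_all_exists[beta0 good0] := admissible_exists.
have /fin_all_exists[beta1 good1] := fun z => admissible_last z good0.
(* [rep] depends only on the orbit, so exactly one coefficient per cycle is the corrected one;
   orbits are nonempty, so the default is never reached there. *)
pose rep (O : {set F}) := odflt 0 [pick w in O].
pose gamma z := if z == rep (porbit pi z) then beta1 z else beta0 z.
have good z : z \in M -> admissible z (gamma z).
  by move=> zM; rewrite /gamma; case: ifP => _; [case: (good1 z zM) | apply: good0].
have gs : {in M, forall z, gamma z ^+ s = alpha z ^+ s} by move=> z /good[].
have same_order z k : z \in M ->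
    ((\prod_(w in porbit pi z) gamma w) ^+ k == 1) = (A z ^+ k == 1).
  move=> zM; set O := porbit pi z; pose r := rep O.
  have rO : r \in O.
    by rewrite /r /rep; case: pickP => //= /(_ z); rewrite porbit_id.
  have OE w : w \in O -> porbit pi w = O by rewrite -eq_porbit_mem => /eqP.
  have rM : r \in M by exact: porbit_coset_reps rO.
  have [_ /(_ k)] := good1 r rM; rewrite !OE // => <-.
  rewrite (bigD1 r) //= {1}/gamma OE // eqxx; congr ((_ * _) ^+ k == 1).
  by apply: eq_bigr => w /andP[wO wr]; rewrite /gamma OE // (negPf wr).
have f_inj := coset_map_inj dsq gE gs.
have fE x : perm f_inj x = gamma (x ^+ s) * x by rewrite permE.
exists (perm f_inj); split; first by exists gamma.
- apply: cycle_type_eq => x; apply: card_porbit_eq => k.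
  have [->|x0] := eqVneq x 0.
    have fix0 (p : {perm F}) : p 0 = 0 -> ((p ^+ k)%g 0 == 0).
      by move=> p0; rewrite permX; elim: k => //= m /eqP ->; rewrite p0.
    by rewrite !fix0 // ?fE ?gE mulr0.
  rewrite (coset_map_fixed dsq gE k fE gs x0) (coset_map_fixed dsq gE k gE) //.
  by rewrite same_order // coset_power.
- move=> j; apply: injF_bij; have gj : {in M, forall z, (gamma z + c j) ^+ s = alpha z ^+ s}.
    by move=> z /good[].
  apply: eq_inj (coset_map_inj dsq gE gj) _ => x.
  by rewrite fE mulrDl.
Qed.
End Replacement.

(** * From long cycles to a bounded index *)

Theorem theorem1p1p1 (R : realType) (d n : nat) (eps : R)
    (hd : (0 < d)%N) (hn : (0 < n)%N) (heps : 0 < eps) :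
  exists q0 : nat, (0 < q0)%N /\
    forall (F : finFieldType), (q0 <= #|F|)%N ->
    forall (c : 'I_n -> F) (g : {perm F}),
      cyclotomic_mapping d g ->
      (forall X : {set F}, X \in porbits g -> X \subset [set~ 0] ->
         eps * #|F|%:R <= #|X|%:R) ->
      exists f : {perm F},
        [/\ cyclotomic_mapping d f,
            cycle_type f =1 cycle_type g
          & forall i : 'I_n, bijective (fun x : F => f x + c i * x)].
Proof.
(* A cycle of length between eps q and d o forces D < d / eps; the summand d covers the case D = d
   used for the free coefficients. *)
pose Dmax := (d + Num.bound (d%:R / eps))%N.
have [q0 key] := generator_shifts_uniform n Dmax hd.
exists q0.+1; split=> // F hq c g cyc_g long.
have [s [dsq [alpha gE] back]] := cyclotomic_mappingP cyc_g.
have key' o D c' := key F (ltnW hq) s o D c' dsq.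
have porbit_neq0 x : x != 0 -> porbit g x \subset [set~ 0].
  move=> x0; apply/subsetP => _ /porbitP[i ->]; rewrite !inE permX.
  by elim: i => //= i IH; apply: coset_map_neq0 gE _ IH.
have index_bound x o D : x != 0 -> (#|porbit g x| <= d * o)%N -> (D * o).+1 = #|F| -> (D <= Dmax)%N.
  move=> x0 xo Do; have o0 : (0 < o)%N.
    by move: xo; case: o {Do} => //; rewrite muln0 leqn0 (negPf (card_porbit_neq0 _ _)).
  have := long _ (imset_f _ (isT : x \in F)) (porbit_neq0 x x0).
  have xo' : #|porbit g x|%:R <= d%:R * o%:R :> R by rewrite -natrM ler_nat.
  move=> /le_trans/(_ xo'); rewrite -Do => /(le_trans _).
  have DoS : eps * (D%:R * o%:R) <= eps * (D * o).+1%:R.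
    by rewrite ler_pM2l // -natrM ler_nat.
  move=> /(_ _ DoS); rewrite mulrA ler_pM2r ?ltr0n // mulrC -ler_pdivlMr // => DR.
  rewrite (leq_trans _ (leq_addl _ _)) // ltnW // -(ltr_nat R).
  apply: le_lt_trans DR (archi_boundP _).
  by rewrite divr_ge0 ?ler0n // ltW.
have [f [[gamma fE] ct bij]] := replacement c hd dsq gE key' (leq_addr _ _) index_bound.
by exists f; split=> //; apply: back fE.
Qed.
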